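(* Let $\alpha\ge-1/2$ and let $0 < \sigma < \alpha+1$. Then $$\mathbb K^{\alpha,\sigma}(x,y) \simeq (|x|+|y|)^{-2\alpha-1} \begin{cases} |x-y|^{2\sigma-1}, & \sigma<1/2,\\ \log\frac{2(|x|+|y|)}{|x-y|}, & \sigma=1/2,\\ (|x|+|y|)^{2\sigma-1}, & \sigma>1/2, \end{cases}$$ uniformly in $x,y \in \mathbb{R}$.
   Context: For $\alpha>-1$ let $I_\alpha$ denote the modified Bessel function of the first kind of order $\alpha$, and for $t,x,y>0$ let $$W_t^{\alpha}(x,y)=\frac{1}{2t}\exp\Big(-\frac{x^2+y^2}{4t}\Big)(xy)^{-\alpha}I_\alpha\Big(\frac{xy}{2t}\Big),$$ extended to $x=0$ or $y=0$ by taking limits. The Dunkl heat kernel is $$\mathbb W_t^{\alpha}(x,y)=\frac12\Big[W_t^{\alpha}(|x|,|y|)+xy\,W_t^{\alpha+1}(|x|,|y|)\Big],\qquad x,y\in\mathbb R,\ t>0,$$ and the corresponding Riesz potential kernel is $$\mathbb K^{\alpha,\sigma}(x,y)=\frac1{\Gamma(\sigma)}\int_0^\infty \mathbb W_t^{\alpha}(x,y)\,t^{\sigma-1}\,dt,\qquad x,y\in\mathbb R.$$ $X\simeq Y$ means $C^{-1}Y\le X\le CY$ with $C>0$ independent of $x,y$. Positive expressions are valued in $[0,\infty]$, with natural limiting interpretations (e.g. $0^\beta=\infty$ for $\beta<0$). *)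

(* Defs.v *)
From HB Require Import structures.
From mathcomp Require Import all_boot all_order all_algebra.
From mathcomp Require Import all_classical all_reals all_analysis.

Set Implicit Arguments.
Unset Strict Implicit.
Unset Printing Implicit Defensive.

Import Order.TTheory GRing.Theory Num.Theory.
Import numFieldNormedType.Exports.

Local Open Scope classical_set_scope.
Local Open Scope ring_scope.

(* Outside A, the value is the limit along A; it is meaningful only at points
   of the closure of A where this limit exists. *)
Definition extend_by_limit (T : topologicalType) (U : ptopologicalType)
    (A : set T) (f : T -> U) (p : T) : U :=
  if p \in A then f p else lim (f @ within A (nbhs p)).

(* Euler's integral, hence the Gamma function only for s > 0. *)
Definition euler_gamma (R : realType) (s : R) : R :=
  \int[@lebesgue_measure R]_(t in `]0, +oo[%classic)
    (t `^ (s - 1) * expR (- t)).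

(* Modified Bessel function of the first kind, for order a > -1 and z > 0. *)
Definition besselI (R : realType) (a z : R) : R :=
  limn (series (fun k : nat =>
    (z / 2) `^ (2 * k%:R + a) / (k`!%:R * euler_gamma (k%:R + a + 1)))).

Definition bessel_heat_pos (R : realType) (a t : R) (p : R * R) : R :=
  (2 * t)^-1 * expR (- (p.1 ^+ 2 + p.2 ^+ 2) / (4 * t)) *
  (p.1 * p.2) `^ (- a) * besselI a (p.1 * p.2 / (2 * t)).

Definition bessel_heat (R : realType) (a t x y : R) : R :=
  extend_by_limit [set p : R * R | 0 < p.1 /\ 0 < p.2]
    (bessel_heat_pos a t) (x, y).

Definition dunkl_heat (R : realType) (a t x y : R) : R :=
  2^-1 * (bessel_heat a t `|x| `|y| + x * y * bessel_heat (a + 1) t `|x| `|y|).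

Definition dunkl_riesz_kernel (R : realType) (a s x y : R) : \bar R :=
  (((euler_gamma s)^-1)%R%:E *
   \int[@lebesgue_measure R]_(t in `](0 : R)%R, +oo[%classic)
     (dunkl_heat a t x y * t `^ (s - 1))%R%:E)%E.

(* Power of r >= 0 with the convention 0^b = +oo for b < 0; the library's powR
   gives 0 there. *)
Definition powRy (R : realType) (r b : R) : \bar R :=
  if (r == 0) && (b < 0) then +oo%E else (r `^ b)%:E.

(* On the diagonal x = y != 0 the quotient in the logarithm is +oo, since
   0^-1 = +oo in \bar R. *)
Definition riesz_size_off0 (R : realType) (a s : R) (p : R * R) : \bar R :=
  let S := `|p.1| + `|p.2| in
  let D := `|p.1 - p.2| in
  (powRy S (- 2 * a - 1) *
   if (s < 2^-1)%R then powRy D (2 * s - 1)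
   else if (s == 2^-1)%R then lne ((2 * S)%R%:E / D%:E)
   else powRy S (2 * s - 1))%E.

(* The formula can be +oo * 0 at the origin, which the library evaluates to 0,
   and involves the quotient 0 / 0 when s = 1/2; the value there is the limit. *)
Definition riesz_size (R : realType) (a s x y : R) : \bar R :=
  extend_by_limit [set p : R * R | p != (0, 0)] (riesz_size_off0 a s) (x, y).

(* Main.v *)
Require Import Defs.
From HB Require Import structures.
From mathcomp Require Import all_boot all_order all_algebra.
From mathcomp Require Import all_classical all_reals all_analysis.
From mathcomp Require Import measurable_realfun ring lra.

Set Implicit Arguments.
Unset Strict Implicit.
Unset Printing Implicit Defensive.

Import Order.TTheory GRing.Theory Num.Theory.
Import numFieldNormedType.Exports.

Local Open Scope classical_set_scope.
Local Open Scope ring_scope.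

(** Put q = x^2 + y^2 and u = 2xy/q, so that u is in [-1, 1], and
b = a + 1 - s > 0. Let F_c(w) be the entire series with
I_c(z) = (z/2)^c F_c((z/2)^2). The heat kernel is
(4t)^(-a-1) e^(-q/(4t)) [F_a(p^2) + p F_(a+1)(p^2)] with p = xy/(4t), and the
substitution w = q/(4t) turns the potential kernel into a constant times
q^(-b) Phi(u), where
Phi(u) is the integral over w > 0 of
w^(b-1) e^(-w) [F_a((uw/2)^2) + (uw/2) F_(a+1)((uw/2)^2)].
So everything reduces to the behaviour of Phi on [-1, 1], together with the
elementary facts that q is comparable to S^2, S = |x| + |y|, and that
1 - u^2 = (S |x-y| / q)^2 when xy >= 0.

For u >= 0, termwise integration gives a power series in u whose even part
has coefficients Gamma(2k+b) / (4^k k! Gamma(k+a+1)) and whose odd part is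
dominated by the even part. The recursion of these coefficients is that of a
quotient of products P_k(al) = prod_(j < k) (j + al)/(j + 1), and
P_k(al) is comparable to (k+1)^(al-1); hence they are comparable to
(k+1)^(-s-1/2). The series of (k+1)^(-s-1/2) v^k at v = u^2 is comparable to
(1-v)^(s-1/2) if s < 1/2 (binomial series), to 1 - ln(1-v) if s = 1/2, and to
1 if s > 1/2 (rising_ratio_asymp, moment_coef_asymp, polylog_lt1,
polylog1_le, polylog1_ge, polylog_gt1_bounded).

For u <= 0 we have |x-y| = S and must show that Phi(u) is comparable to 1.
The lower bound is pointwise: e^(2p) [F_a(p^2) - p F_(a+1)(p^2)] is
nondecreasing in p >= 0, because its derivative is
(2a+1) e^(2p) F_(a+1)(p^2), which is nonnegative as a >= -1/2
(bessel_series_sub_ge). The upper bound comes from the cancellation between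
consecutive even and odd terms when u > -1 (even_partial_le), and extends to
u = -1 by Fatou's lemma (dunkl_riesz_profile_neg).

At the origin both sides are infinite. *)

(** * Integrals over the half-line *)

Section HalfLine.
Context {R : realType}.
Implicit Types (f g : R -> R) (s t c : R).
Local Notation mu := (@lebesgue_measure R).
Local Notation D := (`](0 : R), +oo[%classic).

Definition pos_continuous f := forall t, 0 < t -> {for t, continuous f}.

Lemma pos_continuous_measurable f : pos_continuous f ->
  measurable_fun D f.
Proof.
move=> cf; apply: open_continuous_measurable_fun.
  exact: interval_open.
by move=> t; rewrite inE/= in_itv/= andbT => t0; exact: cf.
Qed.

Lemma pos_continuous_within f (x y : R) : pos_continuous f -> 0 < x ->
  {within `[x, y], continuous f}.
Proof.
move=> cf x0; apply: continuous_in_subspaceT => t.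
rewrite inE/= in_itv/= => /andP[xt _]; apply: cf; exact: lt_le_trans x0 xt.
Qed.

Let win c (n : nat) := `[c / n.+1%:R, c * n.+1%:R]%classic.

Let win_bigcup c : 0 < c -> \bigcup_n win c n = D.
Proof.
move=> c0; apply/seteqP; split => t /=.
  case=> n _; rewrite /win/= !in_itv/= andbT => /andP[+ _].
  by apply: lt_le_trans; rewrite divr_gt0.
rewrite in_itv/= andbT => t0.
pose n := `|Num.ceil (Num.max (t / c) (c / t))|%N.
have [h1 h2] : t / c <= n.+1%:R /\ c / t <= n.+1%:R.
  have : Num.max (t / c) (c / t) <= n.+1%:R.
    apply: le_trans (ceil_ge _) _; rewrite -natr1.
    apply: le_trans (ler_norm _) _; rewrite -intr_norm.
    by rewrite /n natr_absz lerDl.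
  by rewrite ge_max => /andP[].
exists n => //; rewrite /win/= in_itv/=; apply/andP; split.
  by rewrite ler_pdivrMr// mulrC -ler_pdivrMr.
by rewrite mulrC -ler_pdivrMr.
Qed.

(** The windows carry a parameter c because the substitution t |-> c/t maps
the windows with parameter 1 onto those with parameter c. *)
Lemma cvg_window_integral f c : pos_continuous f ->
  (forall t, 0 < t -> 0 <= f t) -> 0 < c ->
  (\int[mu]_(t in `[(c / n.+1%:R)%R, (c * n.+1%:R)%R]) (f t)%:E)%E
    @[n --> \oo] --> (\int[mu]_(t in D) (f t)%:E)%E.
Proof.
move=> cf f0 c0; rewrite -(win_bigcup c0).
have wpos n t : win c n t -> 0 < t.
  rewrite /win/= in_itv/= => /andP[+ _].
  by apply: lt_le_trans; rewrite divr_gt0.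
apply: (@ge0_nondecreasing_set_cvg_integral _ (measurableTypeR R) R (win c)).
- apply/nondecreasing_seqP => n; rewrite subsetEset => t.
  rewrite /win/= !in_itv/= => /andP[h1 h2]; apply/andP; split.
    apply: le_trans h1; rewrite ler_pM2l// lef_pV2 ?posrE//.
    by rewrite ler_nat.
  by apply: (le_trans h2); rewrite ler_pM2l// ler_nat.
- by move=> n; exact: measurable_itv.
- move=> n; apply/measurable_EFinP.
  apply: measurable_funS (pos_continuous_measurable cf) => //.
  by move=> t /wpos /= t0; rewrite in_itv/= t0.
- by move=> n t /wpos t0; rewrite lee_fin f0.
Qed.

(** The inversion t |-> c/t turns the exponent -q/(4t) of a heat kernel into
-w, and used twice it also yields the linear change of variables. *)
Lemma pos_integral_inversion f c : pos_continuous f ->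
  (forall t, 0 < t -> 0 <= f t) -> 0 < c ->
  (\int[mu]_(t in D) (f t)%:E = \int[mu]_(t in D) (f (c / t) * (c / t ^+ 2))%:E)%E.
Proof.
move=> cf f0 c0.
have dF t : 0 < t -> is_derive t 1 (fun x : R => c / x) (- (c / t ^+ 2)).
  move=> t0.
  have tn0 : t != 0 by rewrite gt_eqF.
  have dV : is_derive t 1 (fun x : R => x^-1) (- t ^- 2).
    apply: DeriveDef; first exact: derivableV.
    by rewrite (@deriveV _ _ id)// derive_id /GRing.scale/= mulr1.
  have := is_deriveZ c dV.
  by rewrite scalerN.
have cF t : 0 < t -> {for t, continuous (fun x : R => c / x)}.
  move=> t0; apply: differentiable_continuous; apply/derivable1_diffP.
  by have [] := dF _ t0.
have cdF : pos_continuous (fun t => c / t ^+ 2).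
  move=> t t0; apply: cvgM; first exact: cvg_cst.
  apply: cvgV; first by rewrite expf_neq0// gt_eqF.
  exact: exprn_continuous.
have cG : pos_continuous (fun t => f (c / t) * (c / t ^+ 2)).
  move=> t t0; apply: cvgM; last exact: cdF.
  apply: (@continuous_comp _ _ _ (fun x : R => c / x) f); first exact: cF.
  by apply: cf; rewrite divr_gt0.
have G0 t : 0 < t -> 0 <= f (c / t) * (c / t ^+ 2).
  by move=> t0; rewrite mulr_ge0 ?f0 ?divr_ge0 ?exprn_ge0// ?divr_gt0// ltW.
have L := cvg_window_integral cf f0 c0.
have Rr := cvg_window_integral cG G0 ltr01.
apply: (cvg_unique (@ereal_hausdorff R) L).
rewrite (_ : (fun n : nat => _) = (fun n =>
   \int[mu]_(t in `[(1 / n.+1%:R)%R, (1 * n.+1%:R)%R]) (f (c / t) * (c / t ^+ 2))%:E)%E)//.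
apply/funext => n.
set x := (1 / n.+1%:R); set y := 1 * n.+1%:R.
have x0 : 0 < x by rewrite divr_gt0.
have y0 : 0 < y by rewrite mulr_gt0.
have xy : x <= y.
  rewrite /x /y div1r mul1r (@le_trans _ _ 1)//.
    by rewrite invf_le1// ler1n.
  by rewrite ler1n.
have -> : c / n.+1%:R = c / y by rewrite /y mul1r.
have -> : c * n.+1%:R = c / x by rewrite /x div1r invrK.
have dE t : 0 < t -> derive1 (fun x : R => c / x) t = - (c / t ^+ 2).
  by move=> t0; rewrite derive1E; have [_ ->] := dF _ t0.
have cd' t : 0 < t -> {for t, continuous (derive1 (fun x : R => c / x))}.
  move=> t0.
  apply: (@cvg_trans _ ((fun x : R => - (c / x ^+ 2)) x @[x --> t])).
    apply: near_eq_cvg; near=> z; rewrite dE//.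
    by near: z; exact: lt_nbhsr.
  by rewrite /continuous_at dE//; exact: (cvgN (cdF t t0)).
have sub t : t \in `]x, y[ -> 0 < t.
  by rewrite in_itv/= => /andP[+ _]; exact: lt_trans.
rewrite (@integration_by_substitution_decreasing R (fun x => c / x) f x y xy).
- apply: eq_integral => t; rewrite inE/= in_itv/= => /andP[xt _].
  have t0 : 0 < t := lt_le_trans x0 xt.
  by rewrite !fctE dE// opprK.
- move=> u v /=; rewrite !in_itv/= => /andP[xu _] /andP[xv _] vu.
  have v0 := lt_le_trans x0 xv; have u0 := lt_le_trans x0 xu.
  by rewrite ltr_pM2l// ltf_pV2.
- by move=> t /sub /cd'.
- apply/cvg_ex; eexists; apply: cvg_at_right_filter; exact: cd'.
- apply/cvg_ex; eexists; apply: cvg_at_left_filter; exact: cd'.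
- split.
  + by move=> t /sub /dF[].
  + apply: cvg_at_right_filter; exact: cF.
  + apply: cvg_at_left_filter; exact: cF.
- by apply: pos_continuous_within => //; rewrite divr_gt0.
Unshelve. all: end_near. Qed.

Lemma pos_integral_scaling f c : pos_continuous f ->
  (forall t, 0 < t -> 0 <= f t) -> 0 < c ->
  (\int[mu]_(t in D) (f t)%:E = c%:E * \int[mu]_(t in D) (f (c * t))%:E)%E.
Proof.
move=> cf f0 c0.
have cg : pos_continuous (fun t => f (c * t)).
  move=> t t0; apply: (@continuous_comp _ _ _ (fun x : R => c * x) f).
    exact: mulrl_continuous.
  by apply: cf; rewrite mulr_gt0.
have g0 t : 0 < t -> 0 <= f (c * t) by move=> t0; rewrite f0// mulr_gt0.
(* Composing the inversions t |-> c/t and t |-> 1/t gives t |-> c t. *)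
rewrite (pos_integral_inversion cf f0 c0).
rewrite -ge0_integralZl_EFin//=; last 3 first.
- by move=> t; rewrite in_itv/= andbT => t0; rewrite lee_fin g0.
- by apply/measurable_EFinP; exact: pos_continuous_measurable.
- exact: ltW.
rewrite (@pos_integral_inversion (fun t => c * f (c * t)) 1)//; last 2 first.
- by move=> t t0; apply: cvgM; [exact: cvg_cst|exact: cg].
- by move=> t t0; rewrite mulr_ge0 ?g0// ltW.
apply: eq_integral => t _; congr EFin.
by rewrite mul1r div1r -mulrA mulrCA.
Qed.

End HalfLine.

(** * Euler's Gamma function *)

Section EulerGamma.
Context {R : realType}.
Implicit Types (f g : R -> R) (s t c : R).
Local Notation mu := (@lebesgue_measure R).
Local Notation D := (`](0 : R), +oo[%classic).

Lemma pos_continuousM f g : pos_continuous f -> pos_continuous g ->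
  pos_continuous (fun t => f t * g t).
Proof. by move=> cf cg t t0; apply: cvgM; [exact: cf|exact: cg]. Qed.

Lemma pos_continuous_powR s : pos_continuous (fun t : R => t `^ s).
Proof.
move=> t t0; apply: differentiable_continuous; apply/derivable1_diffP.
by apply: derivable_powR; rewrite in_itv/= t0.
Qed.

Lemma pos_continuous_expRN : pos_continuous (fun t : R => expR (- t)).
Proof.
move=> t _; apply: (@continuous_comp _ _ _ (fun t : R => - t) expR).
  exact: opp_continuous.
exact: continuous_expR.
Qed.

Lemma window_FTC (F f : R -> R) (x y : R) : pos_continuous f ->
  (forall t, 0 < t -> is_derive t 1 F (f t)) -> 0 < x -> x < y ->
  (\int[mu]_(t in `[x, y]) (f t)%:E = (F y - F x)%:E)%E.
Proof.
move=> cf dF x0 xy; rewrite EFinB.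
have cF t : 0 < t -> {for t, continuous F}.
  move=> t0; apply: differentiable_continuous; apply/derivable1_diffP.
  by have [] := dF _ t0.
have sub t : t \in `]x, y[ -> 0 < t.
  by rewrite in_itv/= => /andP[+ _]; exact: lt_trans.
apply: continuous_FTC2 => //.
- exact: pos_continuous_within.
- split.
  + by move=> t /sub /dF[].
  + apply: cvg_at_right_filter; exact: cF.
  + apply: cvg_at_left_filter; apply: cF; exact: lt_trans xy.
- by move=> t /sub t0; rewrite derive1E; have [_ ->] := dF _ t0.
Qed.

(** A consequence of ln x < x at x = t/(2s): the constant is (2s)^s. *)
Lemma powR_le_expR s : 0 < s ->
  exists2 C : R, 0 < C & forall t, 0 < t -> t `^ s <= C * expR (t / 2).
Proof.
move=> s0; exists ((2 * s) `^ s); first by rewrite powR_gt0// mulr_gt0.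
move=> t t0.
have s20 : 0 < 2 * s by rewrite mulr_gt0.
rewrite /powR !gt_eqF// -expRD ler_expR -lerBlDl -mulrBr -ln_div ?posrE//.
have : ln (t / (2 * s)) < t / (2 * s) by apply: ln_sublinear; rewrite divr_gt0.
move/ltW; rewrite -(ler_pM2l s0) => /le_trans; apply.
by rewrite le_eqVlt; apply/orP; left; apply/eqP; field; rewrite gt_eqF.
Qed.

Definition gamma_density s t := t `^ (s - 1) * expR (- t).

Lemma gamma_density_continuous s : pos_continuous (gamma_density s).
Proof.
exact: pos_continuousM (@pos_continuous_powR _) pos_continuous_expRN.
Qed.

Lemma gamma_density_ge0 s t : 0 <= gamma_density s t.
Proof. by rewrite mulr_ge0// ?powR_ge0 ?expR_ge0. Qed.

(** The density is dominated by a multiple of the derivative of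
-(1 + t^s)^-1, which has total mass 1 on the half-line. *)
Lemma gamma_density_integral_lty s : 0 < s ->
  (\int[mu]_(t in D) (gamma_density s t)%:E < +oo)%E.
Proof.
move=> s0.
pose F t := - (1 + t `^ s)^-1.
pose f t := s * t `^ (s - 1) * (1 + t `^ s) ^- 2.
have p1 t : 0 < 1 + t `^ s by rewrite ltr_pwDl// powR_ge0.
have cf : pos_continuous f.
  move=> t t0; apply: cvgM.
    by apply: cvgM; [exact: cvg_cst|exact: pos_continuous_powR].
  apply: cvgV; first by rewrite expf_neq0// gt_eqF.
  apply: (@continuous_comp _ _ _ (fun t : R => 1 + t `^ s) (fun x => x ^+ 2)).
    by apply: cvgD; [exact: cvg_cst|exact: pos_continuous_powR].
  exact: exprn_continuous.
have f0 t : 0 < t -> 0 <= f t.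
  by move=> t0; rewrite !mulr_ge0 ?powR_ge0 ?invr_ge0 ?exprn_ge0 ?(ltW (p1 _))// ltW.
have dF t : 0 < t -> is_derive t 1 F (f t).
  move=> t0.
  have d1 : is_derive t 1 (fun t : R => 1 + t `^ s) (s * t `^ (s - 1)).
    have := is_deriveD (is_derive_cst (1:R) t 1) (is_derive1_powR s t0).
    by rewrite add0r.
  have d2 : is_derive t 1 (fun t : R => (1 + t `^ s)^-1) (- f t).
    apply: DeriveDef.
      by apply: derivableV; [rewrite gt_eqF|case: d1].
    rewrite deriveV ?gt_eqF//.
    by case: d1 => _ ->; rewrite /f /GRing.scale/= mulNr mulrC.
  by have := is_deriveN d2; rewrite opprK.
have If : (\int[mu]_(t in D) (f t)%:E <= 1)%E.
  have L := cvg_window_integral cf f0 ltr01.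
  have := cvg_lim (@ereal_hausdorff R) L => <-.
  apply: lime_le; first by apply/cvg_ex; eexists; exact: L.
  near=> n.
  have n1 : (0 < n)%N by near: n; exists 1%N.
  have xy : 1 / n.+1%:R < 1 * n.+1%:R :> R.
    by rewrite div1r mul1r (@lt_trans _ _ 1)// ?invf_lt1 ?ltr1n ?ltnS.
  rewrite (window_FTC cf dF)//.
  rewrite lee_fin /F opprK addrC lerBlDr ler_wpDr//.
  by rewrite invf_le1// lerDl powR_ge0.
have [C C0 HC] := powR_le_expR s0.
have B t : 0 < t -> gamma_density s t <= (s^-1 * (1 + C) ^+ 2) * f t.
  move=> t0; rewrite /gamma_density /f.
  rewrite (_ : _ * (_ * _ / _) =
      t `^ (s - 1) * ((1 + C) ^+ 2 * (1 + t `^ s) ^- 2)); last first.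
    by field; rewrite !gt_eqF.
  rewrite ler_wpM2l ?powR_ge0// ler_pdivlMr ?exprn_gt0//.
  rewrite expRN ler_pdivrMl ?expR_gt0//.
  have -> : expR t = expR (t / 2) ^+ 2.
    by rewrite expr2 -expRD; congr expR; field.
  rewrite -exprMn ler_sqr ?nnegrE; last 2 first.
  - exact: ltW.
  - by rewrite mulr_ge0 ?expR_ge0// addr_ge0// ltW.
  have e1 : 1 <= expR (t / 2) by rewrite -expR0 ler_expR divr_ge0// ltW.
  by rewrite mulrC mulrDl mul1r lerD ?HC.
apply: (@le_lt_trans _ _ ((s^-1 * (1 + C) ^+ 2)%:E * 1)%E); last by rewrite mule1 ltry.
apply: (@le_trans _ _ ((s^-1 * (1 + C) ^+ 2)%:E * \int[mu]_(t in D) (f t)%:E)%E); last first.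
  by rewrite lee_pmul2l// lte_fin mulr_gt0 ?invr_gt0// exprn_gt0// addr_gt0.
rewrite -ge0_integralZl_EFin//=; last 3 first.
- by move=> t; rewrite in_itv/= andbT => t0; rewrite lee_fin f0.
- by apply/measurable_EFinP; exact: pos_continuous_measurable.
- by rewrite mulr_ge0 ?invr_ge0 ?exprn_ge0// ?addr_ge0// ltW.
apply: ge0_le_integral => //=.
- by move=> t _; rewrite lee_fin gamma_density_ge0.
- apply/measurable_EFinP; exact: (pos_continuous_measurable (@gamma_density_continuous s)).
- apply: emeasurable_funM; first exact: measurable_cst.
  by apply/measurable_EFinP; exact: pos_continuous_measurable.
- by move=> t; rewrite in_itv/= andbT => t0; rewrite -EFinM lee_fin B.
Unshelve. all: end_near. Qed.

Lemma euler_gammaE s : 0 < s ->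
  (\int[mu]_(t in D) (gamma_density s t)%:E = (euler_gamma s)%:E)%E.
Proof.
move=> s0; rewrite /euler_gamma /Rintegral fineK//.
rewrite ge0_fin_numE; first exact: gamma_density_integral_lty.
by apply: integral_ge0 => t _; rewrite lee_fin gamma_density_ge0.
Qed.

(** On [1, 2] the density stays above 2^(-|s-1|) e^(-2). *)
Lemma euler_gamma_gt0 s : 0 < s -> 0 < euler_gamma s.
Proof.
move=> s0; rewrite -lte_fin -euler_gammaE//.
set r := `|s - 1|.
pose m := (2 `^ r)^-1 * expR (- 2) : R.
have m0 : 0 < m by rewrite mulr_gt0 ?invr_gt0 ?powR_gt0 ?expR_gt0.
apply: (@lt_le_trans _ _ (\int[mu]_(t in `[1%R, 2%R]) (cst m%:E t))%E).
  rewrite integral_cst//= lebesgue_measure_itv/= lte_fin ltr1n/=.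
  by rewrite -EFinB -EFinM lte_fin mulr_gt0// subr_gt0 ltr1n.
apply: (@le_trans _ _ (\int[mu]_(t in `[1%R, 2%R]) (gamma_density s t)%:E)%E).
  apply: ge0_le_integral => //=.
  - by move=> t _; rewrite lee_fin ltW.
  - apply/measurable_EFinP.
    apply: measurable_funS (pos_continuous_measurable (@gamma_density_continuous s)) => //.
    by move=> t /=; rewrite !in_itv/= andbT => /andP[t1 _]; exact: lt_le_trans t1.
  - move=> t; rewrite in_itv/= => /andP[t1 t2]; rewrite lee_fin.
    have t0 : 0 < t by exact: lt_le_trans t1.
    rewrite ler_pM ?invr_ge0 ?powR_ge0 ?expR_ge0 ?ler_expR ?lerN2//.
    apply: (@le_trans _ _ (t `^ (- r))).
      rewrite powRN lef_pV2 ?posrE ?powR_gt0// ge0_ler_powR ?nnegrE//.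
    - exact: normr_ge0.
    - exact: ltW.
    by apply: ler_powR => //; rewrite /r lerNl -normrN ler_norm.
apply: ge0_subset_integral => //=.
- apply/measurable_EFinP; exact: (pos_continuous_measurable (@gamma_density_continuous s)).
- by move=> t _; rewrite lee_fin gamma_density_ge0.
- by move=> t /=; rewrite !in_itv/= andbT => /andP[t1 _]; exact: lt_le_trans t1.
Qed.

(** The boundary terms t^s e^(-t) of the integration by parts vanish at both
ends of the windows. *)
Lemma euler_gammaS s : 0 < s -> euler_gamma (s + 1) = s * euler_gamma s.
Proof.
move=> s0; apply: EFin_inj; rewrite EFinM -!euler_gammaE ?addr_gt0//.
pose F t := t `^ s * expR (- t).
pose h t := s * gamma_density s t - gamma_density (s + 1) t.
have cg r := @gamma_density_continuous r.
have ch : pos_continuous h.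
  move=> t t0; apply: cvgB; last exact: cg.
  by apply: cvgM; [exact: cvg_cst|exact: cg].
have dF t : 0 < t -> is_derive t 1 F (h t).
  move=> t0.
  have d2 : is_derive t 1 (fun t : R => expR (- t)) (- expR (- t)).
    have := @is_derive1_comp _ expR -%R t _ _ (is_derive_expR _) (is_deriveNid _ _).
    by rewrite mulrN1.
  have := is_deriveM (is_derive1_powR s t0) d2.
  rewrite /GRing.scale/= /h /gamma_density addrK addrC mulrN.
  by rewrite mulrCA [expR _ * _]mulrC.
have L := cvg_window_integral (@cg (s + 1)) (fun t _ => gamma_density_ge0 _ t) ltr01.
have sg0 t : 0 < t -> 0 <= s * gamma_density s t.
  by move=> t0; rewrite mulr_ge0 ?gamma_density_ge0// ltW.
have csg : pos_continuous (fun t => s * gamma_density s t).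
  by move=> t t0; apply: cvgM; [exact: cvg_cst|exact: cg].
have L2 := cvg_window_integral csg sg0 ltr01.
have -> : (s%:E * \int[mu]_(t in D) (gamma_density s t)%:E =
    \int[mu]_(t in D) (s * gamma_density s t)%:E)%E.
  rewrite -ge0_integralZl_EFin//=; last 3 first.
  - by move=> t _; rewrite lee_fin gamma_density_ge0.
  - by apply/measurable_EFinP; exact: pos_continuous_measurable.
  - exact: ltW.
have F0 : (F n.+1%:R - F (n.+1%:R^-1)) @[n --> \oo] --> (0 : R).
  rewrite -[X in _ --> X](subr0 (0:R)); apply: cvgB.
    have [C C0 HC] := powR_le_expR s0.
    apply: (@squeeze_cvgr _ _ _ _ (cst 0) (fun n : nat => C * expR (- n.+1%:R / 2))).
    - near=> n; rewrite /cst mulr_ge0 ?powR_ge0 ?expR_ge0//=.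
      rewrite /F (_ : - n.+1%:R / 2 = n.+1%:R / 2 - n.+1%:R); last by field.
      by rewrite expRD mulrA ler_wpM2r ?expR_ge0// HC.
    - exact: cvg_cst.
    - rewrite -[X in _ --> X](mulr0 C); apply: cvgM; first exact: cvg_cst.
      have -> : (fun n : nat => expR (- n.+1%:R / 2)) =
          (fun n : nat => expR (- 2^-1) ^+ n.+1 : R).
        by apply/funext => n; rewrite -expRM_natr mulNr mulrC mulNr.
      rewrite (cvg_shiftS (fun n => expR (- 2^-1) ^+ n)).
      by apply: cvg_expr; rewrite ger0_norm ?expR_ge0// expR_lt1 oppr_lt0 invr_gt0.
  apply: (@squeeze_cvgr _ _ _ _ (cst 0) (fun n : nat => n.+1%:R^-1 `^ s)).
  - near=> n; rewrite /cst mulr_ge0 ?powR_ge0 ?expR_ge0//=.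
    by rewrite ler_piMr ?powR_ge0// expR_le1 oppr_le0 invr_ge0.
  - exact: cvg_cst.
  - apply: (cvg_comp (fun n : nat => n.+1%:R^-1) (fun x : R => x `^ s) _ (powR_cvg0 s0)).
    move=> A /= [e e0 HA]; have := @cvg_harmonic R.
    move=> /cvgrPdist_lt /(_ e e0); apply: filterS => n Hn.
    apply: HA => /=; last by rewrite invr_gt0.
    by [].
have E : (fun n : nat => \int[mu]_(t in `[(1 / n.+1%:R)%R, (1 * n.+1%:R)%R])
    (s * gamma_density s t)%:E)%E @ \oo -->
    (0%:E + \int[mu]_(t in D) (gamma_density (s + 1) t)%:E)%E.
  apply: (@cvg_trans _ ((fun n : nat => (F n.+1%:R - F (n.+1%:R^-1))%:E +
    \int[mu]_(t in `[(1 / n.+1%:R)%R, (1 * n.+1%:R)%R]) (gamma_density (s + 1) t)%:E)%E @ \oo)).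
    apply: near_eq_cvg; near=> n.
    have x0 : 0 < 1 / n.+1%:R :> R by rewrite divr_gt0.
    have n1 : (0 < n)%N by near: n; exists 1%N.
    have xy : 1 / n.+1%:R < 1 * n.+1%:R :> R.
      by rewrite div1r mul1r (@lt_trans _ _ 1)// ?invf_lt1 ?ltr1n ?ltnS.
    have ci f : pos_continuous f ->
        mu.-integrable `[1 / n.+1%:R, 1 * n.+1%:R] (EFin \o f).
      move=> cf; apply: continuous_compact_integrable; first exact: segment_compact.
      exact: pos_continuous_within.
    transitivity (\int[mu]_(t in `[(1 / n.+1%:R)%R, (1 * n.+1%:R)%R])
        ((h t)%:E + (gamma_density (s + 1) t)%:E))%E.
      rewrite integralD//=; [|exact: (ci h)|exact: (ci _ (cg _))].
      by rewrite (window_FTC ch dF x0 xy); congr (_ + _)%E; rewrite mul1r div1r.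
    by apply: eq_integral => t _; rewrite -EFinD /h subrK.
  apply: cvgeD => //.
  by apply: cvg_EFin; [exact: nearW|exact: F0].
have := cvg_unique (@ereal_hausdorff R) L2 E.
by rewrite add0e => ->.
Unshelve. all: end_near. Qed.

End EulerGamma.

(** * Two-sided bounds for real families *)

Section TwoSidedBounds.
Context {R : realType}.

Definition two_sided (T : Type) (u v : T -> R) :=
  exists2 C : R, 0 < C & forall x, C^-1 * v x <= u x <= C * v x.

Lemma two_sidedI (T : Type) (u v : T -> R) (m M : R) : 0 < m -> 0 < M ->
  (forall x, 0 <= v x) -> (forall x, m * v x <= u x <= M * v x) ->
  two_sided u v.
Proof.
move=> m0 M0 v0 uv; exists (Num.max m^-1 M); first by rewrite lt_max M0 orbT.
move=> x; have /andP[h1 h2] := uv x; apply/andP; split.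
  apply: le_trans h1; apply: ler_wpM2r => //.
  rewrite -[leRHS]invrK lef_pV2 ?posrE ?invr_gt0 ?lt_max ?M0 ?orbT//.
  by rewrite le_max lexx.
by apply: (le_trans h2); apply: ler_wpM2r => //; rewrite le_max lexx orbT.
Qed.

Lemma two_sidedM (T : Type) (u v w z : T -> R) :
  (forall x, 0 <= v x) -> (forall x, 0 <= z x) ->
  two_sided u v -> two_sided w z ->
  two_sided (fun x => u x * w x) (fun x => v x * z x).
Proof.
move=> v0 z0 [C C0 uv] [E E0 wz]; exists (C * E); first by rewrite mulr_gt0.
move=> x; have /andP[h1 h2] := uv x; have /andP[h3 h4] := wz x.
have cv : 0 <= C^-1 * v x by rewrite mulr_ge0 ?invr_ge0// ltW.
have ez : 0 <= E^-1 * z x by rewrite mulr_ge0 ?invr_ge0// ltW.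
rewrite invfM ![_ * (v x * z x)]mulrACA; apply/andP; split.
  exact: ler_pM.
by apply: ler_pM => //; [exact: le_trans h1|exact: le_trans h3].
Qed.

Lemma two_sidedV (T : Type) (u v : T -> R) :
  (forall x, 0 < v x) -> two_sided u v ->
  two_sided (fun x => (u x)^-1) (fun x => (v x)^-1).
Proof.
move=> v0 [C C0 uv]; exists C => // x; have /andP[h1 h2] := uv x.
have cv : 0 < C^-1 * v x by rewrite mulr_gt0 ?invr_gt0.
have u0 : 0 < u x := lt_le_trans cv h1.
rewrite -invfM -[X in X * _^-1]invrK -invfM !lef_pV2 ?posrE ?h1 ?h2//.
by rewrite mulr_gt0.
Qed.

Lemma two_sidedZ (T : Type) (u v : T -> R) (c : R) : 0 < c ->
  (forall x, 0 <= v x) -> two_sided u v -> two_sided (fun x => c * u x) v.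
Proof.
move=> c0 v0 [C C0 uv].
apply: (@two_sidedI _ _ _ (c * C^-1) (c * C)) => //; rewrite ?mulr_gt0 ?invr_gt0//.
by move=> x; rewrite -!mulrA !ler_pM2l.
Qed.

End TwoSidedBounds.

(** * Growth of quotients of Gamma functions *)

Section RisingRatio.
Context {R : realType}.
Implicit Types (al be p x : R) (k n : nat).

(** Gamma(k + al) / (Gamma(al) k!), the k-th coefficient of (1 - v)^(-al). *)
Definition rising_ratio al k : R := \prod_(j < k) ((j%:R + al) / j.+1%:R).

Lemma rising_ratio0 al : rising_ratio al 0 = 1.
Proof. by rewrite /rising_ratio big_ord0. Qed.

Lemma rising_ratioS al k :
  rising_ratio al k.+1 = rising_ratio al k * ((k%:R + al) / k.+1%:R).
Proof. by rewrite /rising_ratio big_ord_recr. Qed.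

Lemma rising_ratio_gt0 al k : 0 < al -> 0 < rising_ratio al k.
Proof.
move=> al0; rewrite prodr_gt0// => j _; rewrite divr_gt0//.
by rewrite ltr_wpDl.
Qed.

Lemma rising_ratio_shift al k : 0 < al ->
  rising_ratio (al + 1) k = rising_ratio al k * ((k%:R + al) / al).
Proof.
move=> al0; elim: k => [|k IH].
  by rewrite !rising_ratio0 add0r divff ?gt_eqF// mulr1.
rewrite !rising_ratioS IH -natr1; field.
by rewrite (gt_eqF al0) natr1 pnatr_eq0.
Qed.

Lemma euler_gamma_rising al k : 0 < al ->
  euler_gamma (k%:R + al) = euler_gamma al * (k`!%:R * rising_ratio al k).
Proof.
move=> al0; elim: k => [|k IH]; first by rewrite add0r rising_ratio0 !mulr1.
rewrite -natr1 addrAC euler_gammaS ?ltr_wpDl// IH rising_ratioS factS natrM.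
by field; rewrite nat1r pnatr_eq0.
Qed.

Lemma bernoulli_powR p x : 0 <= p <= 1 -> 0 <= x ->
  (1 + x) `^ p <= 1 + p * x.
Proof.
move=> /andP[p0 p1] x0.
(* Weighted concavity of ln: the bounds h1 and h2, from ln (1 + z) <= z, are
   combined with weights p and 1 - p, for which their right-hand sides cancel. *)
have y0 : 0 < 1 + p * x by rewrite ltr_pwDl// mulr_ge0.
have x10 : 0 < 1 + x by rewrite ltr_pwDl.
rewrite /powR gt_eqF// -[leRHS]lnK ?posrE// ler_expR.
set y := 1 + p * x in y0 *.
have h1 : ln (1 + x) - ln y <= (1 - p) * x / y.
  have z0 : 0 <= (1 - p) * x / y.
    by rewrite divr_ge0 ?(ltW y0)// mulr_ge0// subr_ge0.
  rewrite -ln_div ?posrE// (_ : (1 + x) / y = 1 + (1 - p) * x / y).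
    by apply: (@le_ln1Dx R); lra.
  by rewrite /y; field; exact: lt0r_neq0.
have h2 : - ln y <= - (p * x / y).
  have e : y^-1 = 1 + - (p * x / y) by rewrite /y; field; exact: lt0r_neq0.
  have z1 : - 1 < - (p * x / y).
    by rewrite ltrN2 ltr_pdivrMr// mul1r /y ltrDr.
  by apply: le_trans (le_ln1Dx z1); rewrite -e lnV.
have p1' : 0 <= 1 - p by rewrite subr_ge0.
have := lerD (ler_wpM2l p0 h1) (ler_wpM2l p1' h2).
lra.
Qed.

(** By induction: the factor 1 + (al - 1)/(k + 1) of the recursion dominates
(1 + 1/(k + 1))^(al - 1) by Bernoulli's inequality, as al - 1 is in [0, 1]. *)
Lemma rising_ratio_ge_12 al k : 1 <= al <= 2 ->
  k.+1%:R `^ (al - 1) <= rising_ratio al k.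
Proof.
move=> /andP[al1 al2]; elim: k => [|k IH].
  by rewrite rising_ratio0 powR1.
have k0 : 0 < k.+1%:R :> R by [].
have -> : k.+2%:R = k.+1%:R * (1 + k.+1%:R^-1) :> R.
  by rewrite mulrDr mulr1 divff ?gt_eqF// natr1.
rewrite powRM ?addr_ge0 ?invr_ge0// rising_ratioS ler_pM ?powR_ge0//.
rewrite (_ : (k%:R + al) / k.+1%:R = 1 + (al - 1) / k.+1%:R).
  by apply: bernoulli_powR; rewrite ?invr_ge0//; apply/andP; split; lra.
by rewrite -natr1; field; rewrite natr1 pnatr_eq0.
Qed.

Lemma rising_ratio_ge_01 al k : 0 < al <= 1 ->
  al * k.+1%:R `^ (al - 1) <= rising_ratio al k.
Proof.
move=> /andP[al0 al1].
have h : k.+1%:R `^ al <= rising_ratio (al + 1) k.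
  by have := @rising_ratio_ge_12 (al + 1) k; rewrite addrK; apply; apply/andP; split; lra.
rewrite rising_ratio_shift// mulrA ler_pdivlMr// in h.
have k0 : 0 < k.+1%:R :> R by [].
rewrite -(ler_pM2r k0) -!mulrA [_ `^ _ * _]mulrC mulr_powRB1//.
rewrite mulrC (le_trans h)// ler_wpM2l ?(ltW (rising_ratio_gt0 _ _))//.
by rewrite -natr1 lerD2l.
Qed.

(** Reflection: P_k(al) P_k(2 - al) is a product of factors
1 - ((al - 1) / (j + 1))^2, so a lower bound at 2 - al is an upper bound
at al. *)
Lemma rising_ratio_le_12 al k : 1 <= al < 2 ->
  rising_ratio al k <= (2 - al)^-1 * k.+1%:R `^ (al - 1).
Proof.
move=> /andP[al1 al2].
have al0 : 0 < al by lra.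
have be0 : 0 < 2 - al by lra.
have h : rising_ratio al k * rising_ratio (2 - al) k <= 1.
  rewrite /rising_ratio -big_split/= -[leRHS](big1_eq (idx:=1) (op:= *%R) (index_enum 'I_k) xpredT).
  apply: ler_prod => j _; apply/andP; split.
    by rewrite mulr_ge0// divr_ge0// addr_ge0// ltW.
  rewrite mulrACA -invfM ler_pdivrMr ?mulr_gt0// mul1r -natr1.
  have : 0 <= (al - 1) ^+ 2 by rewrite sqr_ge0.
  nra.
have b := @rising_ratio_ge_01 (2 - al) k.
have {}b : (2 - al) * k.+1%:R `^ (1 - al) <= rising_ratio (2 - al) k.
  have -> : 1 - al = 2 - al - 1 by ring.
  by apply: b; apply/andP; split; lra.
have k0 : 0 < k.+1%:R :> R by [].
rewrite (_ : al - 1 = - (1 - al)); last by ring.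
rewrite powRN -invfM -[leLHS]invrK lef_pV2 ?posrE ?mulr_gt0 ?powR_gt0 ?invr_gt0 ?rising_ratio_gt0//.
rewrite (le_trans b)// -[leRHS]mul1r ler_pdivlMr ?rising_ratio_gt0// mulrC.
exact: h.
Qed.

Let P_asymp al := two_sided (rising_ratio al) (fun k => k.+1%:R `^ (al - 1)).

Let shift_asymp al : 0 < al ->
  two_sided (fun k => (k%:R + al) / al) (fun k => k.+1%:R).
Proof.
move=> al0; pose m := Num.min 1 al; pose M := Num.max 1 al.
have m0 : 0 < m by rewrite lt_min ltr01.
have M0 : 0 < M by rewrite lt_max ltr01.
apply: (@two_sidedI _ _ _ _ (m / al) (M / al)); rewrite ?divr_gt0//.
move=> k; rewrite ![_ / al * _]mulrAC !ler_pM2r ?invr_gt0// -natr1 !mulrDr !mulr1.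
apply/andP; split; apply: lerD; rewrite ?ler_piMl ?ler_peMl//.
- by rewrite ge_min lexx.
- by rewrite ge_min lexx orbT.
- by rewrite le_max lexx.
- by rewrite le_max lexx orbT.
Qed.

Let P_asympS al : 0 < al -> P_asymp al -> P_asymp (al + 1).
Proof.
move=> al0 h; have := two_sidedM _ _ h (shift_asymp al0).
move=> /(_ (fun k => powR_ge0 _ _) (fun k => ler0n _ _)) [C C0 H]; exists C => // k.
by rewrite addrK rising_ratio_shift// -(mulr_powRB1 (ler0n R k.+1) al0) [_%:R * _]mulrC.
Qed.

Let P_asymp_pred al : 0 < al -> P_asymp (al + 1) -> P_asymp al.
Proof.
move=> al0 h.
have V := two_sidedV (fun k => ltr0Sn R k) (shift_asymp al0).
have := two_sidedM _ _ h V.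
move=> /(_ (fun k => powR_ge0 _ _)).
case=> [k|C C0 H]; first by rewrite invr_ge0.
exists C => // k; have := H k.
rewrite addrK rising_ratio_shift// mulfK//.
  by rewrite -(mulr_powRB1 (ler0n R k.+1) al0) mulrAC divff ?mul1r.
by rewrite gt_eqF// divr_gt0// ltr_wpDl.
Qed.

(** The bounds on [1, 2) propagate to all positive parameters, because shifting
al by 1 multiplies P_k by (k + al)/al, which is comparable to k + 1. *)
Lemma rising_ratio_asymp al : 0 < al ->
  two_sided (rising_ratio al) (fun k => k.+1%:R `^ (al - 1)).
Proof.
have base be : 1 <= be < 2 -> P_asymp be.
  move=> /andP[b1 b2]; apply: (@two_sidedI _ _ _ _ 1 (2 - be)^-1) => //.
  - by rewrite invr_gt0 subr_gt0.
  move=> k; rewrite mul1r rising_ratio_ge_12 ?rising_ratio_le_12 ?b1 ?b2//=.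
  exact: ltW.
have main n : forall be, 0 < be -> be < n%:R + 1 -> P_asymp be.
  elim: n => [|n IH] be be0 ben.
    by apply: P_asymp_pred => //; apply: base; apply/andP; split; lra.
  have [b1|b1] := ltP be 1.
    by apply: P_asymp_pred => //; apply: base; apply/andP; split; lra.
  have [b2|b2] := ltP be 2; first by apply: base; rewrite b1.
  rewrite -(subrK 1 be); apply: P_asympS; first by lra.
  apply: IH; first by lra.
  by rewrite ltrBlDr natr1.
move=> al0; apply: (main (Num.truncn al)) => //.
by rewrite natr1; have /andP[] := truncn_itv (ltW al0).
Qed.

(** The reciprocals Q_k of P_k(1 + e) decrease, with
Q_k - Q_(k+1) = Q_k e / (k + 1 + e) of order k^(-1-e). *)
Lemma sum_powRN_bounded e : 0 < e -> exists2 M : R, 0 < M &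
  forall n, \sum_(0 <= k < n) k.+1%:R `^ (- 1 - e) <= M.
Proof.
move=> e0.
have e10 : 0 < 1 + e by lra.
have [C C0 HC] := rising_ratio_asymp e10.
pose Q k := (rising_ratio (1 + e) k)^-1.
have Q0 k : 0 < Q k by rewrite invr_gt0 rising_ratio_gt0.
pose M := C * (1 + e) / e.
have M0 : 0 < M by rewrite divr_gt0 ?mulr_gt0.
exists M => // n.
suff H : \sum_(0 <= k < n) k.+1%:R `^ (- 1 - e) <= M * (1 - Q n).
  by rewrite (le_trans H)// ler_piMr ?(ltW M0)// gerBl ltW.
elim: n => [|n IH].
  by rewrite big_nil /Q rising_ratio0 invr1 subrr mulr0.
rewrite big_nat_recr//= (_ : 1 - Q n.+1 = 1 - Q n + (Q n - Q n.+1)); last by ring.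
rewrite mulrDr lerD//.
have k0 : 0 < n.+1%:R :> R by [].
have hk : 0 < n%:R + (1 + e) by rewrite ltr_wpDl.
have -> : Q n - Q n.+1 = Q n * (e / (n%:R + (1 + e))).
  rewrite {2}/Q rising_ratioS invfM -/(Q n) -natr1; field.
  by rewrite gt_eqF// natr1 pnatr_eq0.
have hQ : n.+1%:R `^ (- e) <= C * Q n.
  have /andP[_] := HC n.
  rewrite (_ : 1 + e - 1 = e); last by ring.
  move=> h; rewrite powRN /Q -[C]invrK -invfM lef_pV2 ?posrE ?powR_gt0//.
    by rewrite mulrC ler_pdivrMr// mulrC.
  by rewrite mulr_gt0 ?invr_gt0 ?rising_ratio_gt0.
rewrite powRD; last by rewrite (gt_eqF k0) implybT.
rewrite [leLHS]mulrC.
rewrite powR_inv1// /M.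
rewrite (_ : C * _ / e * _ = (C * Q n) * ((1 + e) / (n%:R + (1 + e)))); last first.
  by field; rewrite !gt_eqF.
apply: ler_pM; rewrite ?powR_ge0 ?invr_ge0//.
rewrite ler_pdivlMr// mulrC ler_pdivrMr// -natr1.
have : 0 <= n%:R :> R by [].
nra.
Qed.

End RisingRatio.

(** * The power series of the modified Bessel functions *)

Section BesselSeries.
Context {R : realType}.
Implicit Types (c w z : R) (k n : nat).

Definition bessel_coef c k : R := (k`!%:R * euler_gamma (k%:R + c + 1))^-1.

(** The entire function F_c with I_c(z) = (z/2)^c F_c((z/2)^2). *)
Definition bessel_series c w := limn (pseries (bessel_coef c) w).

Let order_gt0 c k : -1 < c -> 0 < k%:R + c + 1.
Proof. by move=> c1; have : 0 <= k%:R :> R by []; lra. Qed.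

Lemma bessel_coef_gt0 c k : -1 < c -> 0 < bessel_coef c k.
Proof.
move=> c1; rewrite invr_gt0 mulr_gt0 ?ltr0n ?fact_gt0//.
by rewrite euler_gamma_gt0// order_gt0.
Qed.

Lemma bessel_coef_contig c k : -1 < c ->
  bessel_coef c k = (k%:R + c + 1) * bessel_coef (c + 1) k.
Proof.
move=> c1; have h := order_gt0 k c1.
rewrite /bessel_coef addrA (euler_gammaS h).
have g0 := euler_gamma_gt0 h.
have f0 : k`!%:R != 0 :> R by rewrite pnatr_eq0 -lt0n fact_gt0.
by field; rewrite f0 !gt_eqF.
Qed.

Lemma bessel_coef_diffs c : pseries_diffs (bessel_coef c) = bessel_coef (c + 1).
Proof.
apply/funext => k; rewrite /pseries_diffs /bessel_coef factS natrM.
rewrite (_ : k.+1%:R + c + 1 = k%:R + (c + 1) + 1); last by rewrite -natr1; ring.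
by rewrite -[in LHS]mulrA invfM mulrA divff ?mul1r// pnatr_eq0.
Qed.

Lemma bessel_coefS c k : -1 < c ->
  bessel_coef c k.+1 = bessel_coef c k / (k.+1%:R * (k%:R + c + 1)).
Proof.
move=> c1; have h := order_gt0 k c1.
have e : bessel_coef (c + 1) k = k.+1%:R * bessel_coef c k.+1.
  by rewrite -bessel_coef_diffs.
have h' : k%:R + c + 1 != 0 by rewrite gt_eqF.
have k1 : k.+1%:R != 0 :> R by rewrite pnatr_eq0.
rewrite (bessel_coef_contig k c1) e [X in _ = X / _]mulrCA mulrA.
by rewrite [RHS]mulrC mulKf ?mulf_neq0.
Qed.

Let bessel_coef_le c k : -1 < c ->
  bessel_coef c k <= bessel_coef c 0 * ((c + 1)^-1 ^+ k / k`!%:R).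
Proof.
move=> c1; have c10 : 0 < c + 1 by lra.
elim: k => [|k IH]; first by rewrite expr0 fact0 divr1 mulr1.
rewrite bessel_coefS// factS natrM exprS.
have -> : bessel_coef c 0 * ((c + 1)^-1 * (c + 1)^-1 ^+ k / (k.+1%:R * k`!%:R)) =
    bessel_coef c 0 * ((c + 1)^-1 ^+ k / k`!%:R) * (k.+1%:R * (c + 1))^-1.
  rewrite !(invfM k.+1%:R).
  move: (bessel_coef c 0) ((c + 1)^-1 ^+ k) (k`!%:R^-1) (k.+1%:R^-1) (c + 1)^-1 => *.
  by ring.
apply: ler_pM => //; first by rewrite ltW// bessel_coef_gt0.
  by rewrite invr_ge0 mulr_ge0// ltW// order_gt0.
rewrite lef_pV2 ?posrE ?mulr_gt0// ?order_gt0//.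
by rewrite ler_pM2l// -addrA lerDr.
Qed.

Lemma is_cvg_bessel_series c w : -1 < c -> cvgn (pseries (bessel_coef c) w).
Proof.
move=> c1; apply: normed_cvg.
apply: (@series_le_cvg _ _ (fun k => bessel_coef c 0 *
    exp_coeff ((c + 1)^-1 * `|w|) k)) => [k|k|k|] /=.
- exact: normr_ge0.
- rewrite mulr_ge0//; first by rewrite ltW// bessel_coef_gt0.
  by rewrite exp_coeff_ge0// mulr_ge0// invr_ge0; lra.
- rewrite normrM normrX ger0_norm; last by rewrite ltW// bessel_coef_gt0.
  rewrite /exp_coeff/= exprMn mulrAC mulrA ler_wpM2r ?exprn_ge0//.
  exact: bessel_coef_le.
- by apply: is_cvg_seriesZ; exact: is_cvg_series_exp_coeff.
Qed.

Lemma is_derive_bessel_series c w : -1 < c ->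
  is_derive w 1 (bessel_series c) (bessel_series (c + 1) w).
Proof.
move=> c1.
have := @pseries_snd_diffs R (bessel_coef c) (`|w| + 1) w.
rewrite !bessel_coef_diffs; apply; try by apply: is_cvg_bessel_series; lra.
by rewrite ltr_normr ltrDl ltr01.
Qed.

Lemma continuous_bessel_series c : -1 < c -> continuous (bessel_series c).
Proof.
move=> c1 w; apply: differentiable_continuous; apply/derivable1_diffP.
by have [] := is_derive_bessel_series w c1.
Qed.

Lemma bessel_series_ge c w : -1 < c -> 0 <= w ->
  bessel_coef c 0 <= bessel_series c w.
Proof.
move=> c1 w0; have h := @is_cvg_bessel_series c w c1.
have nd : nondecreasing_seq (pseries (bessel_coef c) w).
  apply/nondecreasing_seqP => n; rewrite /pseries seriesSr lerDl.
  by rewrite mulr_ge0 ?exprn_ge0// ltW// bessel_coef_gt0.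
have := nondecreasing_cvgn_le nd h 1%N.
suff -> : bessel_coef c 0 = pseries (bessel_coef c) w 1%N by [].
transitivity (\sum_(0 <= i < 1) bessel_coef c i * w ^+ i) => //.
by rewrite big_nat1 expr0 mulr1.
Qed.

Lemma bessel_series_ge0 c w : -1 < c -> 0 <= w -> 0 <= bessel_series c w.
Proof.
by move=> c1 w0; rewrite (le_trans _ (bessel_series_ge c1 w0))// ltW// bessel_coef_gt0.
Qed.

Lemma bessel_series0 c : bessel_series c 0 = bessel_coef c 0.
Proof.
apply: cvg_lim => //.
apply: (@cvg_trans _ (cst (bessel_coef c 0) @ \oo)); last exact: cvg_cst.
apply: near_eq_cvg; exists 1%N => // -[//|n] _ /=.
rewrite /pseries /series/= big_nat_recl//= expr0 mulr1 big1 ?addr0//.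
by move=> i _; rewrite exprS mul0r mulr0.
Qed.

Lemma bessel_series_nneseries c w : -1 < c -> 0 <= w ->
  ((bessel_series c w)%:E = \sum_(k <oo) (bessel_coef c k * w ^+ k)%:E)%E.
Proof.
move=> c1 w0; rewrite /bessel_series -EFin_lim; last exact: is_cvg_bessel_series.
by congr (lim (_ @ \oo)); apply/funext => n; rewrite /= /pseries /series/= sumEFin.
Qed.

(** The recurrence z (I_(nu-1) - I_(nu+1)) = 2 nu I_nu at nu = c + 1. *)
Lemma bessel_series_contig c w : -1 < c ->
  bessel_series c w = (c + 1) * bessel_series (c + 1) w + w * bessel_series (c + 2) w.
Proof.
move=> c1.
have c2 : -1 < c + 1 by lra.
have E : c + 1 + 1 = c + 2 by ring.
have h1 := @is_cvg_bessel_series _ w c2.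
have h2 := @pseries_diffs_equiv R (bessel_coef (c + 1)) w.
rewrite bessel_coef_diffs E in h2.
have {}h2 := h2 (@is_cvg_bessel_series _ w (ltac:(lra) : -1 < c + 2)).
apply: cvg_lim => //.
have H : (fun n => (c + 1) * pseries (bessel_coef (c + 1)) w n +
   w * series (fun i => i%:R * bessel_coef (c + 1) i * w ^+ i.-1) n) @ \oo -->
   (c + 1) * bessel_series (c + 1) w + w * bessel_series (c + 2) w.
  apply: cvgD; apply: cvgM; try exact: cvg_cst.
    exact: h1.
  exact: h2.
apply: cvg_trans H; apply: near_eq_cvg; near=> n.
rewrite /pseries /series/= !mulr_sumr -big_split/=; apply: eq_bigr => k _.
rewrite (bessel_coef_contig k c1); case: k => [|k]/=; first by rewrite expr0; ring.
by rewrite exprS; ring.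
Unshelve. all: end_near. Qed.

(** Why the kernel stays positive when x y < 0: the derivative of
e^(2p) [F_a(p^2) - p F_(a+1)(p^2)] is (2a+1) e^(2p) F_(a+1)(p^2) >= 0. *)
Lemma bessel_series_sub_ge a p : - 2^-1 <= a -> 0 <= p ->
  bessel_coef a 0 * expR (- (2 * p)) <=
    bessel_series a (p ^+ 2) - p * bessel_series (a + 1) (p ^+ 2).
Proof.
move=> ha p0.
have a1 : -1 < a by lra.
pose g (x : R) : R := expR (2 * x) *
  (bessel_series a (x ^+ 2) - x * bessel_series (a + 1) (x ^+ 2)).
pose g' (x : R) : R := expR (2 * x) * ((2 * a + 1) * bessel_series (a + 1) (x ^+ 2)).
have dg (x : R) : is_derive x (1:R) g (g' x).
  have dsq : is_derive x (1:R) (fun x : R => x ^+ 2) (2 * x).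
    have := @is_deriveX R R^o id 2 x 1 1 (is_derive_id _ _).
    by rewrite /GRing.scale/= mulr1 expr1.
  have dF c : -1 < c -> is_derive x (1:R) (fun x : R => bessel_series c (x ^+ 2))
      (bessel_series (c + 1) (x ^+ 2) * (2 * x)).
    move=> c1; exact: (is_derive1_comp (is_derive_bessel_series _ c1) dsq).
  have dE : is_derive x (1:R) (fun x : R => expR (2 * x)) (expR (2 * x) * 2).
    have d2 : is_derive x (1:R) (fun x : R => 2 * x) 2.
      have := is_deriveZ (2 : R) (is_derive_id x (1:R)).
      by rewrite /GRing.scale/= mulr1.
    exact: (is_derive1_comp (is_derive_expR _) d2).
  have d1 := is_deriveM (is_derive_id x (1:R)) (dF (a + 1) (ltac:(lra) : -1 < a + 1)).
  have d0 := is_deriveM dE (is_deriveB (dF a a1) d1).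
  apply: is_derive_eq d0 _.
  rewrite /GRing.scale/= /g' !fctE.
  rewrite (bessel_series_contig (x ^+ 2) a1).
  rewrite (_ : a + 1 + 1 = a + 2); last by ring.
  move: (bessel_series (a + 1) _) (bessel_series (a + 2) _) (expR _) => F1 F2 E.
  by ring.
have h : g 0 <= g p.
  apply: (@ger0_derive1_ndecry R g 0) => //.
  - move=> x _; rewrite derive1E; have [_ ->] := dg x.
    rewrite mulr_ge0 ?expR_ge0// mulr_ge0//; first by lra.
    by rewrite bessel_series_ge0 ?sqr_ge0//; lra.
  - apply: continuous_subspaceT => x.
    apply: differentiable_continuous; apply/derivable1_diffP.
    by have [] := dg x.
move: h; rewrite /g mulr0 expR0 mul1r mul0r subr0 expr0n/= bessel_series0.
by rewrite expRN ler_pdivrMr ?expR_gt0// mulrC.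
Qed.

End BesselSeries.

(** * The Dunkl heat kernel and the reduction to one variable *)

Section HeatKernel.
Context {R : realType}.
Implicit Types (a s t b u w p x y : R).
Local Notation mu := (@lebesgue_measure R).
Local Notation D := (`](0 : R), +oo[%classic).

(** This removes the limits from the definition of the heat kernel: on the
boundary of the quadrant it is given by the same convergent series. *)
Lemma extend_by_limit_continuous (T : topologicalType) (U : ptopologicalType)
    (A : set T) (f g : T -> U) (z : T) : hausdorff_space U -> closure A z ->
  {for z, continuous g} -> (forall v, A v -> f v = g v) ->
  extend_by_limit A f z = g z.
Proof.
move=> hU Az cg fg; rewrite /extend_by_limit; case: ifPn => [|_].
  by rewrite inE => /fg.
have PF : ProperFilter (within A (nbhs z)) by exact: within_nbhs_proper.
apply: cvg_lim => //.
apply: (@cvg_trans _ (g @ within A (nbhs z))).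
  by apply: near_eq_cvg; rewrite near_withinE; apply: nearW => w Aw; exact/esym/fg.
by apply: cvg_trans cg; apply: cvg_app; exact: cvg_within.
Qed.

Lemma besselIE a z : -1 < a -> 0 < z ->
  besselI a z = (z / 2) `^ a * bessel_series a ((z / 2) ^+ 2).
Proof.
move=> a1 z0; rewrite /besselI; apply: cvg_lim => //.
have z20 : 0 < z / 2 by rewrite divr_gt0.
have h : (fun n => (z / 2) `^ a * pseries (bessel_coef a) ((z / 2) ^+ 2) n) @ \oo
    --> (z / 2) `^ a * bessel_series a ((z / 2) ^+ 2).
  by apply: cvgM; [exact: cvg_cst|exact: is_cvg_bessel_series].
apply: cvg_trans h; apply: near_eq_cvg; near=> n.
rewrite /pseries /series mulr_sumr; apply: eq_bigr => k _.
rewrite powRD; last by rewrite (gt_eqF z20) implybT.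
rewrite -natrM powR_mulrn ?(ltW z20)// exprM /bessel_coef.
by rewrite /= mulrCA mulrC [X in X * _]mulrC.
Unshelve. all: end_near. Qed.

Lemma closure_open_quadrant x y : 0 <= x -> 0 <= y ->
  closure [set p : R * R | 0 < p.1 /\ 0 < p.2] (x, y).
Proof.
move=> x0 y0 B /nbhs_ballP[e /= e0 eB].
exists (x + e / 2, y + e / 2); split => /=.
  by split; rewrite ltr_wpDl// divr_gt0.
have e2 : `|e / 2| < e by rewrite gtr0_norm ?divr_gt0//; lra.
by apply: eB; split; rewrite /ball/= opprD addNKr normrN.
Qed.

Lemma bessel_heatE a t x y : -1 < a -> 0 < t -> 0 <= x -> 0 <= y ->
  bessel_heat a t x y = (2 * t)^-1 * (4 * t) `^ (- a) *
    expR (- (x ^+ 2 + y ^+ 2) / (4 * t)) * bessel_series a ((x * y / (4 * t)) ^+ 2).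
Proof.
move=> a1 t0 x0 y0; rewrite /bessel_heat.
pose g (p : R * R) := (2 * t)^-1 * (4 * t) `^ (- a) *
    expR (- (p.1 ^+ 2 + p.2 ^+ 2) / (4 * t)) *
    bessel_series a ((p.1 * p.2 / (4 * t)) ^+ 2).
rewrite (@extend_by_limit_continuous _ _ _ _ g)//.
- exact: closure_open_quadrant.
- have c1 : {for (x, y), continuous (fun p : R * R => p.1)} by exact: cvg_fst.
  have c2 : {for (x, y), continuous (fun p : R * R => p.2)} by exact: cvg_snd.
  have cX (f : R * R -> R) : {for (x, y), continuous f} ->
      {for (x, y), continuous (fun v => f v ^+ 2)}.
    move=> cf; apply: (@continuous_comp _ _ _ f (fun r : R => r ^+ 2)) => //.
    exact: exprn_continuous.
  apply: cvgM; first apply: cvgM; first exact: cvg_cst.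
    apply: (@continuous_comp _ _ _ (fun p : R * R => - (p.1 ^+ 2 + p.2 ^+ 2) / (4 * t)) expR).
      apply: cvgM; last exact: cvg_cst.
      by apply: cvgN; apply: cvgD; exact: cX.
    exact: continuous_expR.
  apply: (@continuous_comp _ _ _ (fun p : R * R => (p.1 * p.2 / (4 * t)) ^+ 2) (bessel_series a)).
    apply: (cX (fun p : R * R => p.1 * p.2 / (4 * t))).
    by apply: cvgM; [exact: cvgM|exact: cvg_cst].
  exact: continuous_bessel_series.
move=> [u v] /= [u0 v0]; rewrite /bessel_heat_pos /g/=.
have t40 : 0 < 4 * t by rewrite mulr_gt0.
rewrite besselIE ?divr_gt0 ?mulr_gt0//.
have -> : u * v / (2 * t) / 2 = u * v / (4 * t) by field; rewrite gt_eqF.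
have e : (4 * t)^-1 `^ a = ((4 * t) `^ a)^-1.
  by rewrite -powR_inv1 ?(ltW t40)// -powRrM mulN1r powRN.
rewrite [(_ / _) `^ a]powRM ?invr_ge0 ?mulr_ge0 ?(ltW t0) ?(ltW u0) ?(ltW v0)// e !powRN.
have h : (u * v) `^ a != 0 by rewrite gt_eqF// powR_gt0// mulr_gt0.
move: ((u * v) `^ a) h => X h.
move: (bessel_series _ _) (expR _) ((4 * t) `^ a)^-1 => F E Y.
rewrite -!mulrA; congr (_ * _).
by rewrite mulKf// mulrCA.
Qed.

(** At z = 2p this is 2^a |z|^(-a) (I_a(|z|) + sgn(z) I_(a+1)(|z|)). *)
Definition dunkl_profile a p :=
  bessel_series a (p ^+ 2) + p * bessel_series (a + 1) (p ^+ 2).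

Lemma continuous_dunkl_profile a : -1 < a -> continuous (dunkl_profile a).
Proof.
move=> a1 p.
have c c' : -1 < c' -> {for p, continuous (fun p : R => bessel_series c' (p ^+ 2))}.
  move=> c1; apply: (@continuous_comp _ _ _ (fun p : R => p ^+ 2) (bessel_series c')).
    exact: exprn_continuous.
  exact: continuous_bessel_series.
apply: cvgD; first exact: c.
by apply: cvgM; [exact: cvg_id|apply: c; lra].
Qed.

(** For p < 0 the two Bessel terms nearly cancel; bessel_series_sub_ge keeps
their difference positive. *)
Lemma dunkl_profile_ge a p : - 2^-1 <= a ->
  bessel_coef a 0 * expR (- (2 * `|p|)) <= dunkl_profile a p.
Proof.
move=> ha; rewrite /dunkl_profile; have [p0|p0] := leP 0 p.
  rewrite ler_wpDr//.
    by rewrite mulr_ge0// bessel_series_ge0 ?sqr_ge0//; lra.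
  apply: (@le_trans _ _ (bessel_coef a 0)).
    rewrite ler_piMr ?expR_le1 ?oppr_le0 ?mulr_ge0//.
    by rewrite ltW// bessel_coef_gt0//; lra.
  by apply: bessel_series_ge; rewrite ?sqr_ge0//; lra.
rewrite ltr0_norm//; have p0' : 0 <= - p by rewrite oppr_ge0 ltW.
by have := bessel_series_sub_ge ha p0'; rewrite sqrrN mulNr opprK.
Qed.

Lemma dunkl_profile_ge0 a p : - 2^-1 <= a -> 0 <= dunkl_profile a p.
Proof.
move=> ha; apply: le_trans (dunkl_profile_ge p ha).
by rewrite mulr_ge0 ?expR_ge0// ltW// bessel_coef_gt0//; lra.
Qed.

Lemma dunkl_heatE a t x y : - 2^-1 <= a -> 0 < t ->
  dunkl_heat a t x y = (4 * t) `^ (- a - 1) *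
    expR (- (x ^+ 2 + y ^+ 2) / (4 * t)) * dunkl_profile a (x * y / (4 * t)).
Proof.
move=> ha t0; have t40 : 0 < 4 * t by rewrite mulr_gt0.
rewrite /dunkl_heat !bessel_heatE//; [|lra..].
have -> : (`|x| * `|y| / (4 * t)) ^+ 2 = (x * y / (4 * t)) ^+ 2.
  by rewrite !exprMn !real_normK ?num_real.
rewrite !real_normK ?num_real// /dunkl_profile.
rewrite (opprD a 1) !powRB ?(gt_eqF t40) ?implybT// powRr1 ?(ltW t40)//.
move: (bessel_series _ _) (bessel_series _ _) (expR _) ((4 * t) `^ (- a)) => F1 F2 E Y.
by field; rewrite gt_eqF.
Qed.

(** What is left of the time integral after the substitution
w = (x^2 + y^2)/(4t); it depends on x and y only through
u = 2xy/(x^2 + y^2), a number of [-1, 1]. *)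
Definition dunkl_riesz_profile a b u : \bar R :=
  (\int[mu]_(w in D) (gamma_density b w * dunkl_profile a (u * w / 2))%:E)%E.

Lemma dunkl_riesz_integrand_continuous a b u : -1 < a ->
  pos_continuous (fun w => gamma_density b w * dunkl_profile a (u * w / 2)).
Proof.
move=> a1; apply: pos_continuousM; first exact: gamma_density_continuous.
move=> w _; apply: (@continuous_comp _ _ _ (fun w : R => u * w / 2) (dunkl_profile a)).
  apply: cvgM; last exact: cvg_cst.
  exact: mulrl_continuous.
exact: continuous_dunkl_profile.
Qed.

Definition heat_integrand a s q r t := (4 * t) `^ (- a - 1) *
  expR (- q / (4 * t)) * dunkl_profile a (r / (4 * t)) * t `^ (s - 1).

Lemma heat_integrand_continuous a s q r : -1 < a ->
  pos_continuous (heat_integrand a s q r).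
Proof.
move=> a1.
have c4 : pos_continuous (fun t : R => (4 * t)^-1).
  move=> t t0; apply: cvgV; first by rewrite gt_eqF// mulr_gt0.
  exact: mulrl_continuous.
apply: pos_continuousM; last exact: pos_continuous_powR.
apply: pos_continuousM; first apply: pos_continuousM.
- move=> t t0; apply: (@continuous_comp _ _ _ (fun t : R => 4 * t) (fun t => t `^ (- a - 1))).
    exact: mulrl_continuous.
  by apply: pos_continuous_powR; rewrite mulr_gt0.
- move=> t t0; apply: (@continuous_comp _ _ _ (fun t : R => - q / (4 * t)) expR).
    by apply: cvgM; [exact: cvg_cst|exact: c4].
  exact: continuous_expR.
- move=> t t0; apply: (@continuous_comp _ _ _ (fun t : R => r / (4 * t)) (dunkl_profile a)).
    by apply: cvgM; [exact: cvg_cst|exact: c4].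
  exact: continuous_dunkl_profile.
Qed.

Lemma heat_integrand_ge0 a s q r t : - 2^-1 <= a -> 0 <= heat_integrand a s q r t.
Proof. by move=> ha; rewrite !mulr_ge0 ?powR_ge0 ?expR_ge0 ?dunkl_profile_ge0. Qed.

Lemma dunkl_riesz_kernel_integral a s x y : - 2^-1 <= a ->
  (dunkl_riesz_kernel a s x y = ((euler_gamma s)^-1)%:E *
    \int[mu]_(t in D) (heat_integrand a s (x ^+ 2 + y ^+ 2) (x * y) t)%:E)%E.
Proof.
move=> ha; rewrite /dunkl_riesz_kernel; congr (_ * _)%E.
apply: eq_integral => t; rewrite inE/= in_itv/= andbT => t0.
by rewrite dunkl_heatE.
Qed.

(** Homogeneity: the substitution w = q/(4t) leaves the power q^(s-a-1) in
front of the profile. *)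
Lemma dunkl_riesz_kernelE a s x y : - 2^-1 <= a -> 0 < x ^+ 2 + y ^+ 2 ->
  let q := x ^+ 2 + y ^+ 2 in
  dunkl_riesz_kernel a s x y =
  (((euler_gamma s)^-1 * (4 `^ (- s) * q `^ (s - a - 1)))%:E *
    dunkl_riesz_profile a (a + 1 - s) (2 * (x * y) / q))%E.
Proof.
move=> ha q0 q; rewrite -/q in q0; rewrite dunkl_riesz_kernel_integral// -/q.
have a1 : -1 < a by lra.
rewrite EFinM -muleA; congr (_ * _)%E.
have cf := @heat_integrand_continuous a s q (x * y) a1.
have f0 t : 0 < t -> 0 <= heat_integrand a s q (x * y) t.
  by move=> _; exact: heat_integrand_ge0.
rewrite (pos_integral_inversion cf f0 (divr_gt0 q0 (ltr0Sn R 3))).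
rewrite /dunkl_riesz_profile -ge0_integralZl_EFin//=; last 3 first.
- by move=> w _; rewrite lee_fin mulr_ge0 ?gamma_density_ge0 ?dunkl_profile_ge0.
- apply/measurable_EFinP; apply: pos_continuous_measurable.
  exact: dunkl_riesz_integrand_continuous.
- by rewrite mulr_ge0 ?powR_ge0.
apply: eq_integral => w; rewrite inE/= in_itv/= andbT => w0.
rewrite -EFinM; congr EFin; rewrite /heat_integrand.
have qn0 := lt0r_neq0 q0; have wn0 := lt0r_neq0 w0.
have -> : 4 * (q / 4 / w) = q / w by field; rewrite wn0.
have -> : - q / (q / w) = - w by field; rewrite qn0 wn0.
have -> : x * y / (q / w) = 2 * (x * y) / q * w / 2 by field; rewrite qn0 wn0.
move: (dunkl_profile _ _) => P.
rewrite /gamma_density.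
have pp r : 0 < r -> r = expR (ln r) by move=> r0; rewrite lnK.
have -> : q / 4 / w ^+ 2 = expR (ln q - ln 4 - ln w *+ 2).
  by rewrite -lnXn// -!ln_div ?posrE ?divr_gt0 ?exprn_gt0// -pp// !divr_gt0 ?exprn_gt0.
rewrite {1 2 3 4 5}/powR !gt_eqF ?divr_gt0// !ln_div ?posrE ?divr_gt0//.
(* Both sides are collected into one exponential times the profile. *)
rewrite [LHS](_ : _ = expR ((- a - 1) * (ln q - ln w) + - w +
    (s - 1) * (ln q - ln 4 - ln w) + (ln q - ln 4 - ln w *+ 2)) * P); last first.
  by rewrite !expRD; ring.
rewrite [RHS](_ : _ = expR (- s * ln 4 + (s - a - 1) * ln q +
    (a + 1 - s - 1) * ln w + - w) * P); last by rewrite !expRD; ring.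
by congr (expR _ * _); ring.
Qed.

End HeatKernel.

(** * Termwise integration against the Gamma density *)

Section GammaMoments.
Context {R : realType}.
Implicit Types (a b u v w be : R) (k n : nat).
Local Notation mu := (@lebesgue_measure R).
Local Notation D := (`](0 : R), +oo[%classic).

Lemma gamma_density_moment be w n : 0 < w ->
  gamma_density be w * w ^+ n = gamma_density (n%:R + be) w.
Proof.
move=> w0; rewrite /gamma_density mulrAC -powR_mulrn ?(ltW w0)//.
rewrite -powRD ?(gt_eqF w0) ?implybT//; congr (_ `^ _ * _); ring.
Qed.

Lemma gamma_integral_exp be c : 0 < be -> 0 < c ->
  (\int[mu]_(w in D) (w `^ (be - 1) * expR (- (c * w)))%:E =
   (c `^ (- be) * euler_gamma be)%:E)%E.
Proof.
move=> be0 c0.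
have := euler_gammaE be0.
rewrite (pos_integral_scaling (@gamma_density_continuous _ be)
   (fun t _ => gamma_density_ge0 _ t) c0) => E.
have cf : pos_continuous (fun w => w `^ (be - 1) * expR (- (c * w))).
  apply: pos_continuousM; first exact: pos_continuous_powR.
  move=> w _; apply: (@continuous_comp _ _ _ (fun w : R => - (c * w)) expR).
    by apply: cvgN; exact: mulrl_continuous.
  exact: continuous_expR.
have f0 w : 0 <= w `^ (be - 1) * expR (- (c * w)).
  by rewrite mulr_ge0 ?powR_ge0 ?expR_ge0.
have {}E : ((c `^ be)%:E *
    \int[mu]_(w in D) (w `^ (be - 1) * expR (- (c * w)))%:E = (euler_gamma be)%:E)%E.
  rewrite -E -(mulr_powRB1 (ltW c0) be0) EFinM -muleA; congr (_ * _)%E.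
  rewrite -ge0_integralZl_EFin//=; last 3 first.
  - by move=> t _; rewrite lee_fin.
  - by apply/measurable_EFinP; exact: pos_continuous_measurable.
  - exact: powR_ge0.
  apply: eq_integral => w; rewrite inE/= in_itv/= andbT => w0.
  by rewrite /gamma_density powRM ?(ltW c0) ?(ltW w0)// -EFinM mulrA.
have cb : c `^ be != 0 by rewrite gt_eqF// powR_gt0.
rewrite EFinM -E muleA -EFinM powRN mulVf// mul1e//.
Qed.

(** Monotone convergence: the identity holds in the extended reals, where both
sides may be infinite. *)
Lemma gamma_integral_series be (A : nat -> R) (m : nat -> nat) (g : R -> R) :
  0 < be -> (forall k, 0 <= A k) ->
  (forall w, 0 < w -> ((g w)%:E = \sum_(k <oo) (A k * w ^+ m k)%:E)%E) ->
  (\int[mu]_(w in D) (gamma_density be w * g w)%:E =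
   \sum_(k <oo) (A k * euler_gamma ((m k)%:R + be))%:E)%E.
Proof.
move=> be0 A0 gE.
pose h k w := A k * gamma_density ((m k)%:R + be) w.
transitivity (\int[mu]_(w in D) \sum_(k <oo) (h k w)%:E)%E.
  apply: eq_integral => w; rewrite inE/= in_itv/= andbT => w0.
  rewrite EFinM gE// -nneseriesZl; last first.
    by move=> k _; rewrite lee_fin mulr_ge0 ?exprn_ge0// ltW.
  apply: eq_eseriesr => k _.
  by rewrite -EFinM mulrCA gamma_density_moment.
have mh k : measurable_fun D (EFin \o h k).
  apply/measurable_EFinP; apply: pos_continuous_measurable => w w0.
  by apply: cvgM; [exact: cvg_cst|exact: gamma_density_continuous].
rewrite integral_nneseries//=; [|by move=> k w _; rewrite lee_fin mulr_ge0 ?gamma_density_ge0].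
apply: eq_eseriesr => k _.
rewrite EFinM -euler_gammaE ?ltr_wpDl//.
rewrite -ge0_integralZl_EFin//=.
- by move=> t _; rewrite lee_fin gamma_density_ge0.
- apply/measurable_EFinP; apply: pos_continuous_measurable.
  exact: gamma_density_continuous.
Qed.

Lemma expR_nneseries (x : R) : 0 <= x ->
  ((expR x)%:E = \sum_(k <oo) (k`!%:R^-1 * x ^+ k)%:E)%E.
Proof.
move=> x0; rewrite /expR -EFin_lim; last exact: is_cvg_series_exp_coeff.
congr (lim (_ @ \oo)); apply/funext => n; rewrite /series/= sumEFin.
by congr EFin; apply: eq_bigr => i _; rewrite /exp_coeff/= mulrC.
Qed.

(** Expanding e^(vw) in the integral of w^(al-1) e^(-(1-v)w) over the
half-line, which is Gamma(al) (1-v)^(-al), gives the series termwise. *)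
Lemma binomial_nneseries al v : 0 < al -> 0 <= v < 1 ->
  ((\sum_(k <oo) (rising_ratio al k * v ^+ k)%:E) = ((1 - v) `^ (- al))%:E)%E.
Proof.
move=> al0 /andP[v0 v1].
have c0 : 0 < 1 - v by rewrite subr_gt0.
have G0 := euler_gamma_gt0 al0.
have h : ((euler_gamma al)%:E * \sum_(k <oo) (rising_ratio al k * v ^+ k)%:E =
    (euler_gamma al)%:E * ((1 - v) `^ (- al))%:E)%E.
  rewrite -[RHS]EFinM [in RHS]mulrC -gamma_integral_exp//.
  transitivity (\int[mu]_(w in D) (gamma_density al w * expR (v * w))%:E)%E; last first.
    apply: eq_integral => w _; congr EFin.
    by rewrite /gamma_density -mulrA -expRD; congr (_ * expR _); ring.
  rewrite (@gamma_integral_series _ (fun k => v ^+ k / k`!%:R) id)//.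
  - rewrite -nneseriesZl; last first.
      by move=> k _; rewrite lee_fin mulr_ge0 ?exprn_ge0// ltW// rising_ratio_gt0.
    apply: eq_eseriesr => k _; rewrite -EFinM euler_gamma_rising//; congr EFin.
    have f0 : k`!%:R != 0 :> R by rewrite pnatr_eq0 -lt0n fact_gt0.
    by move: (rising_ratio al k) (v ^+ k) (euler_gamma al) => *; field.
  - by move=> k; rewrite divr_ge0 ?exprn_ge0.
  - move=> w w0; rewrite expR_nneseries ?mulr_ge0 ?(ltW w0)//.
    by apply: eq_eseriesr => k _; rewrite exprMn mulrA [_^-1 * _]mulrC.
have := congr1 (fun x => (((euler_gamma al)^-1)%:E * x)%E) h.
by rewrite !muleA -(EFinM (euler_gamma al)^-1) mulVf ?gt_eqF// !mul1e.
Qed.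

End GammaMoments.

(** * Moments of the Bessel series and power-law series *)

Section RieszProfile.
Context {R : realType}.
Implicit Types (a b c u v w be p : R) (k n : nat).
Local Notation mu := (@lebesgue_measure R).
Local Notation D := (`](0 : R), +oo[%classic).

Definition moment_coef be c k : R :=
  euler_gamma ((2 * k)%:R + be) / 4 ^+ k * bessel_coef c k.

Lemma moment_coef_gt0 be c k : 0 < be -> -1 < c -> 0 < moment_coef be c k.
Proof.
move=> be0 c1; rewrite mulr_gt0 ?bessel_coef_gt0// divr_gt0 ?exprn_gt0//.
by rewrite euler_gamma_gt0// ltr_wpDl.
Qed.

Lemma bessel_series_moment be c u : 0 < be -> -1 < c ->
  (\int[mu]_(w in D) (gamma_density be w * bessel_series c ((u * w / 2) ^+ 2))%:E =
   \sum_(k <oo) (moment_coef be c k * (u ^+ 2) ^+ k)%:E)%E.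
Proof.
move=> be0 c1.
rewrite (@gamma_integral_series _ be
  (fun k => bessel_coef c k * ((u / 2) ^+ 2) ^+ k) (fun k => (2 * k)%N))//.
- apply: eq_eseriesr => k _; congr EFin.
  have e4 : 4 ^+ k != 0 :> R by rewrite expf_neq0.
  have -> : ((u / 2) ^+ 2) ^+ k = (u ^+ 2) ^+ k / 4 ^+ k.
    by rewrite -expr_div_n; congr (_ ^+ _); field.
  rewrite /moment_coef; move: (bessel_coef c k) (euler_gamma _) => B G.
  by move: (4 ^+ k) ((u ^+ 2) ^+ k) e4 => X Y X0; field.
- move=> k; apply: mulr_ge0; first by rewrite ltW// bessel_coef_gt0.
  by apply: exprn_ge0; exact: sqr_ge0.
- move=> w w0; rewrite bessel_series_nneseries ?sqr_ge0//.
  apply: eq_eseriesr => k _; congr EFin.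
  have -> : (u * w / 2) ^+ 2 = (u / 2) ^+ 2 * w ^+ 2 by field.
  by rewrite exprMn mulrA exprM.
Qed.

Lemma moment_coefS be c k : 0 < be -> -1 < c ->
  moment_coef be c k.+1 = moment_coef be c k *
    (((k%:R + be / 2) / k.+1%:R) * ((k%:R + (be + 1) / 2) / k.+1%:R) /
      ((k%:R + (c + 1)) / k.+1%:R)).
Proof.
move=> be0 c1; rewrite /moment_coef.
have h0 : 0 < (2 * k)%:R + be by rewrite ltr_wpDl.
have -> : (2 * k.+1)%:R + be = (2 * k)%:R + be + 1 + 1.
  by rewrite mulnS addnC natrD; ring.
rewrite (euler_gammaS (addr_gt0 h0 ltr01)) (euler_gammaS h0) bessel_coefS// exprS.
have ek : (2 * k)%:R = 2 * k%:R :> R by rewrite natrM.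
have hk : 0 < k%:R + c + 1 by have : 0 <= k%:R :> R by []; lra.
move: (euler_gamma _) (bessel_coef c k) => G B; rewrite ek addrA.
have e4 : 4 ^+ k != 0 :> R by rewrite expf_neq0.
move: (4 ^+ k) e4 => X X0.
by field; rewrite X0 nat1r pnatr_eq0/= gt_eqF.
Qed.

(** Duplication, Gamma(2k + be) = Gamma(be) 4^k (k!)^2 P_k(be/2) P_k((be+1)/2),
makes the coefficient a quotient of rising ratios, whose exponents add up. *)
Lemma moment_coef_asymp be c : 0 < be -> -1 < c ->
  two_sided (moment_coef be c) (fun k => k.+1%:R `^ (be - c - 3 / 2)).
Proof.
move=> be0 c1.
have h1 : 0 < be / 2 by rewrite divr_gt0.
have h2 : 0 < (be + 1) / 2 by rewrite divr_gt0// addr_gt0.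
have h3 : 0 < c + 1 by lra.
pose P (al : R) := rising_ratio al.
have E k : moment_coef be c k = moment_coef be c 0 *
   (P (be / 2) k * P ((be + 1) / 2) k * (P (c + 1) k)^-1).
  elim: k => [|k IH]; first by rewrite /P !rising_ratio0 invr1 !mulr1.
  by rewrite moment_coefS// IH /P !rising_ratioS !invfM !invrK; ring.
have p0 r k : 0 < k.+1%:R `^ r :> R by rewrite powR_gt0.
have p0' r k : 0 <= k.+1%:R `^ r :> R by exact: ltW.
have A1 := rising_ratio_asymp h1.
have A2 := rising_ratio_asymp h2.
have A3 := two_sidedV (p0 _) (rising_ratio_asymp h3).
have A12 := two_sidedM (p0' _) (p0' _) A1 A2.
have Q0 k : 0 <= k.+1%:R `^ (be / 2 - 1) * k.+1%:R `^ ((be + 1) / 2 - 1) :> R.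
  by rewrite mulr_ge0.
have V0 k : 0 <= (k.+1%:R `^ (c + 1 - 1))^-1 :> R by rewrite invr_ge0.
have A := two_sidedM Q0 V0 A12 A3.
have [C C0 H] := two_sidedZ (moment_coef_gt0 0 be0 c1) (fun k => mulr_ge0 (Q0 k) (V0 k)) A.
exists C => // k; rewrite E; have := H k.
suff -> : k.+1%:R `^ (be - c - 3 / 2) = k.+1%:R `^ (be / 2 - 1) *
    k.+1%:R `^ ((be + 1) / 2 - 1) * (k.+1%:R `^ (c + 1 - 1))^-1 :> R by [].
have kn : k.+1%:R != 0 :> R by rewrite pnatr_eq0.
have pD r r' : k.+1%:R `^ r * k.+1%:R `^ r' = k.+1%:R `^ (r + r') :> R.
  by rewrite powRD// kn implybT.
by rewrite -powRN !pD; congr (_ `^ _); field.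
Qed.

(** The ratio of an odd coefficient to the preceding even one is explicit; it
is at most 1, and 1 minus it is of order 1/k. *)
Lemma moment_coef_odd be c k : 0 < be -> -1 < c ->
  moment_coef (be + 1) (c + 1) k / 2 =
  moment_coef be c k * (((2 * k)%:R + be) / ((2 * k)%:R + 2 * (c + 1))).
Proof.
move=> be0 c1; rewrite /moment_coef addrA euler_gammaS ?ltr_wpDl//.
rewrite (bessel_coef_contig k c1).
have hk : 0 < k%:R + c + 1 by have : 0 <= k%:R :> R by []; lra.
move: (euler_gamma _) (bessel_coef _ k) => G B.
have e4 : 4 ^+ k != 0 :> R by rewrite expf_neq0.
move: (4 ^+ k) e4 => X X0.
rewrite natrM; field; rewrite X0/=.
by rewrite -mulrDr addrA mulf_neq0// gt_eqF.
Qed.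

(** The polylogarithm Li_p(v) / v. *)
Definition polylog_series p v : \bar R :=
  (\sum_(k <oo) (k.+1%:R `^ (- p) * v ^+ k)%:E)%E.

Lemma polylog_term_ge0 p v k : 0 <= v -> 0 <= k.+1%:R `^ (- p) * v ^+ k.
Proof. by move=> v0; rewrite mulr_ge0 ?powR_ge0 ?exprn_ge0. Qed.

Lemma two_sided_nneseries (x y : nat -> R) :
  (forall k, 0 <= x k) -> (forall k, 0 <= y k) -> two_sided x y ->
  exists2 C : R, 0 < C & forall v : R, 0 <= v ->
   ((C^-1)%:E * \sum_(k <oo) (y k * v ^+ k)%:E <= \sum_(k <oo) (x k * v ^+ k)%:E
     <= C%:E * \sum_(k <oo) (y k * v ^+ k)%:E)%E.
Proof.
move=> x0 y0 [C C0 xy]; exists C => // v v0.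
have t0 (z : nat -> R) : (forall k, 0 <= z k) ->
    forall k, (0 <= (z k * v ^+ k)%:E)%E.
  by move=> z0 k; rewrite lee_fin mulr_ge0 ?exprn_ge0.
rewrite -!nneseriesZl; [|by move=> k _; exact: t0..].
apply/andP; split; apply: lee_nneseries => [k _ _|k _].
- by rewrite -EFinM lee_fin !mulr_ge0 ?exprn_ge0 ?invr_ge0// ltW.
- by rewrite -EFinM lee_fin mulrA ler_wpM2r ?exprn_ge0//; have /andP[] := xy k.
- exact: t0.
- by rewrite -EFinM lee_fin mulrA ler_wpM2r ?exprn_ge0//; have /andP[] := xy k.
Qed.

Lemma polylog_ge1 p v : 0 <= v -> (1 <= polylog_series p v)%E.
Proof.
move=> v0.
have := @nneseries_lim_ge R (fun k => (k.+1%:R `^ (- p) * v ^+ k)%:E) xpredT 0 1.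
rewrite big_nat1 powR1 expr0 mulr1; apply => k _ _.
by rewrite lee_fin polylog_term_ge0.
Qed.

Lemma polylog_gt1_bounded p : 1 < p -> exists2 M : R, 0 < M &
  forall v, 0 <= v <= 1 -> (polylog_series p v <= M%:E)%E.
Proof.
move=> p1; have e0 : 0 < p - 1 by rewrite subr_gt0.
have [M M0 H] := sum_powRN_bounded e0; exists M => // v /andP[v0 v1].
apply: lime_le.
  by apply: is_cvg_nneseries => k _ _; rewrite lee_fin polylog_term_ge0.
apply: nearW => n; rewrite sumEFin lee_fin; apply: le_trans (H n).
apply: ler_sum => k _; rewrite (_ : - 1 - (p - 1) = - p); last by ring.
by rewrite ler_piMr ?powR_ge0// exprn_ile1.
Qed.

Lemma polylog_lt1 p : p < 1 -> exists2 C : R, 0 < C &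
  forall v, 0 <= v < 1 ->
   ((C^-1)%:E * ((1 - v) `^ (p - 1))%:E <= polylog_series p v
     <= C%:E * ((1 - v) `^ (p - 1))%:E)%E.
Proof.
move=> p1; have al0 : 0 < 1 - p by rewrite subr_gt0.
have [C C0 H] := rising_ratio_asymp al0.
have H' : two_sided (fun k => k.+1%:R `^ (- p)) (rising_ratio (1 - p)).
  exists C => // k; have /andP[] := H k.
  rewrite (_ : 1 - p - 1 = - p); last by ring.
  by rewrite ler_pdivrMl// => -> /=; rewrite -ler_pdivrMl// => ->.
have [E E0 HE] := two_sided_nneseries
  (fun k => powR_ge0 _ _) (fun k => ltW (rising_ratio_gt0 k al0)) H'.
exists E => // v /andP[v0 v1]; have := HE v v0.
by rewrite binomial_nneseries ?v0// opprB.
Qed.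

(* Partial sums of -ln(1 - v), whose derivative falls short of 1/(1 - v) by
   v^n/(1 - v). *)
Let L n v := \sum_(0 <= k < n) v ^+ k.+1 / k.+1%:R.

Let is_derive_L n v : is_derive v (1:R) (L n) (\sum_(0 <= k < n) v ^+ k).
Proof.
elim: n => [|n IH].
  rewrite big_nil (_ : L 0 = cst 0); first exact: is_derive_cst.
  by apply/funext => x; rewrite /L big_nil.
rewrite big_nat_recr//= (_ : L n.+1 = L n + (n.+1%:R^-1 \*: (fun v : R => v ^+ n.+1))).
  apply: is_deriveD.
  have := is_deriveZ (n.+1%:R^-1) (@is_deriveX R R^o id n.+1 v 1 1 (is_derive_id _ _)).
  rewrite /GRing.scale/= mulr1 mulKf ?pnatr_eq0//.
  rewrite (_ : id ^+ n.+1 = (fun v : R => v ^+ n.+1))//.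
  by apply/funext => x; rewrite exprfctE.
apply/funext => x; rewrite /L big_nat_recr//= !fctE; congr (_ + _).
by rewrite /GRing.scale/= mulrC.
Qed.

Let L0 n : L n 0 = 0.
Proof. by rewrite /L big1// => k _; rewrite exprS !mul0r. Qed.

Let is_derive_ln1B v : v < 1 -> is_derive v (1:R) (fun v : R => - ln (1 - v)) (1 - v)^-1.
Proof.
move=> v1; have h : 0 < 1 - v by rewrite subr_gt0.
have d1 : is_derive v (1:R) (fun v : R => 1 - v) (- 1).
  have := is_deriveB (is_derive_cst (1:R) v 1) (is_derive_id v (1:R)).
  by rewrite sub0r.
have := is_deriveN (@is_derive1_comp R (@ln R) (fun v => 1 - v) v _ _ (is_derive1_ln h) d1).
by rewrite mulrN1 opprK.
Qed.

Let geom n v : v < 1 -> \sum_(0 <= k < n) v ^+ k = (1 - v ^+ n) / (1 - v).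
Proof.
move=> v1; have h : 1 - v != 0 by rewrite gt_eqF// subr_gt0.
elim: n => [|n IH]; first by rewrite big_nil expr0 subrr mul0r.
by rewrite big_nat_recr//= IH exprS; field.
Qed.

Let ndecr (f f' : R -> R) v : 0 <= v < 1 ->
  (forall x, 0 <= x <= v -> is_derive x (1:R) f (f' x)) ->
  (forall x, 0 <= x <= v -> 0 <= f' x) -> f 0 <= f v.
Proof.
move=> /andP[v0 v1] df f'0.
have sub x : x \in `]0, v[ -> 0 <= x <= v.
  by rewrite in_itv/= => /andP[/ltW -> /ltW ->].
apply: (@ger0_derive1_ndecr R f 0 v) => //.
- by move=> x /sub /df [].
- by move=> x /sub xv; rewrite derive1E; have [_ ->] := df x xv; exact: f'0.
apply: continuous_in_subspaceT => x; rewrite inE/= in_itv/= => xv.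
apply: differentiable_continuous; apply/derivable1_diffP.
by have [] := df x xv.
Qed.

Let L_le n v : 0 <= v < 1 -> L n v <= - ln (1 - v).
Proof.
move=> v01; have /andP[v0 v1] := v01.
have := @ndecr (fun x => - ln (1 - x) - L n x) (fun x => x ^+ n / (1 - x)) v v01.
rewrite L0 !subr0 ln1 oppr0 subr_ge0; apply => x /andP[x0 xv].
  have x1 : x < 1 by exact: le_lt_trans xv v1.
  have := is_deriveB (is_derive_ln1B x1) (is_derive_L n x).
  rewrite geom// (_ : (1 - x)^-1 - _ = x ^+ n / (1 - x))//.
  by rewrite mulrBl mul1r opprB addrC subrK.
by rewrite divr_ge0 ?exprn_ge0// subr_ge0 ltW// (le_lt_trans xv).
Qed.

Let L_ge n v : 0 <= v < 1 -> - ln (1 - v) <= L n v + v ^+ n.+1 / (1 - v).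
Proof.
move=> v01; have /andP[v0 v1] := v01.
pose K := v ^+ n / (1 - v).
have := @ndecr (fun x => K * x - (- ln (1 - x) - L n x))
  (fun x => K - x ^+ n / (1 - x)) v v01.
rewrite L0 !subr0 ln1 oppr0 mulr0 subr0 => h.
have {}h : 0 <= K * v - (- ln (1 - v) - L n v).
  apply: h => x /andP[x0 xv].
    have x1 : x < 1 by exact: le_lt_trans xv v1.
    have d0 : is_derive x (1:R) (fun x : R => K * x) K.
      have := is_deriveZ (K : R) (is_derive_id x (1:R)).
      by rewrite /GRing.scale/= mulr1.
    have := is_deriveB d0 (is_deriveB (is_derive_ln1B x1) (is_derive_L n x)).
    rewrite geom// (_ : (1 - x)^-1 - _ = x ^+ n / (1 - x))//.
    by rewrite mulrBl mul1r opprB addrC subrK.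
  rewrite subr_ge0 /K ler_pM ?exprn_ge0 ?invr_ge0 ?subr_ge0//.
  - by rewrite (le_trans xv)// ltW.
  - by rewrite lerXn2r ?nnegrE// (le_trans x0).
  - by rewrite lef_pV2 ?posrE ?subr_gt0// ?(le_lt_trans xv)// lerB.
rewrite -subr_ge0; apply: le_trans h _.
by rewrite le_eqVlt; apply/orP; left; apply/eqP; rewrite exprS /K; ring.
Qed.

Lemma polylog1_le v : 0 <= v < 1 -> (polylog_series 1 v <= (1 - ln (1 - v))%:E)%E.
Proof.
move=> v01; have /andP[v0 v1] := v01.
apply: lime_le.
  by apply: is_cvg_nneseries => k _ _; rewrite lee_fin polylog_term_ge0.
apply: nearW => -[|n].
  rewrite big_nil lee_fin subr_ge0 (le_trans _ ler01)// ln_le0//.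
  by rewrite gerBl.
rewrite sumEFin lee_fin big_nat_recl//= powR1 expr0 mulr1 lerD2l.
apply: le_trans (L_le n v01); apply: ler_sum => k _.
rewrite mulrC ler_wpM2l ?exprn_ge0// powR_inv1// lef_pV2 ?posrE//.
by rewrite ler_nat.
Qed.

(** The partial sums of length n miss -ln(1 - v) by at most v^(n+1)/(1 - v),
which is at most 1 for large n and is absorbed since the series is >= 1. *)
Lemma polylog1_ge v : 0 <= v < 1 -> ((- ln (1 - v))%:E <= 2%:E * polylog_series 1 v)%E.
Proof.
move=> v01; have /andP[v0 v1] := v01.
have v10 : 0 < 1 - v by rewrite subr_gt0.
have [n hn] : exists n, v ^+ n <= 1 - v.
  have : v ^+ n @[n --> \oo] --> (0:R) by apply: cvg_expr; rewrite ger0_norm.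
  move=> /cvgrPdist_le /(_ _ v10) [N _ HN]; exists N.
  by have := HN N (leqnn _); rewrite sub0r normrN ger0_norm ?exprn_ge0.
have h : - ln (1 - v) <= L n v + 1.
  apply: le_trans (L_ge n v01) _; rewrite lerD2l ler_pdivrMr// mul1r exprS.
  by apply: le_trans hn; rewrite ler_piMl ?exprn_ge0// ltW.
apply: (@le_trans _ _ ((L n v)%:E + 1%:E)%E); first by rewrite -EFinD lee_fin.
rewrite [2%:E](_ : _ = 1%:E + 1%:E)%E; last by rewrite -EFinD.
rewrite ge0_muleDl// !mul1e; apply: leeD; last exact: polylog_ge1.
apply: (@le_trans _ _ (\sum_(0 <= k < n) (k.+1%:R `^ (- 1) * v ^+ k)%:E)%E).
  rewrite sumEFin lee_fin; apply: ler_sum => k _.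
  rewrite mulrC powR_inv1// ler_wpM2l// exprS ler_piMl ?exprn_ge0//.
  exact: ltW.
by apply: nneseries_lim_ge => k _ _; rewrite lee_fin polylog_term_ge0.
Qed.

Lemma polylog_series_mono p v v' : 0 <= v <= v' ->
  (polylog_series p v <= polylog_series p v')%E.
Proof.
move=> /andP[v0 vv]; apply: lee_nneseries => [k _ _|k _]; rewrite lee_fin.
  exact: polylog_term_ge0.
by rewrite ler_wpM2l ?powR_ge0// lerXn2r ?nnegrE// (le_trans v0).
Qed.

End RieszProfile.

(** * Bounds for the one-variable profile *)

Section ProfileBounds.
Context {R : realType}.
Implicit Types (a b s u v w : R) (k n : nat).
Local Notation mu := (@lebesgue_measure R).
Local Notation D := (`](0 : R), +oo[%classic).

(* For u >= 0 the profile at u is the sum of its even and odd parts, and the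
   profile at -u is their difference; the latter is stated additively, so that
   it makes sense when both parts are infinite. *)
Let even_series a b u : \bar R :=
  (\sum_(k <oo) (moment_coef b a k * (u ^+ 2) ^+ k)%:E)%E.

Let odd_series a b u : \bar R :=
  (\sum_(k <oo) (moment_coef (b + 1) (a + 1) k / 2 * u * (u ^+ 2) ^+ k)%:E)%E.

Let even_part a b u w := gamma_density b w * bessel_series a ((u * w / 2) ^+ 2).
Let odd_part a b u w :=
  gamma_density b w * (u * w / 2 * bessel_series (a + 1) ((u * w / 2) ^+ 2)).

Let cont_series c u : -1 < c -> pos_continuous (fun w => bessel_series c ((u * w / 2) ^+ 2)).
Proof.
move=> c1 w _.
apply: (@continuous_comp _ _ _ (fun w : R => (u * w / 2) ^+ 2) (bessel_series c)).
  apply: (@continuous_comp _ _ _ (fun w : R => u * w / 2) (fun w => w ^+ 2)).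
    by apply: cvgM; [exact: mulrl_continuous|exact: cvg_cst].
  exact: exprn_continuous.
exact: continuous_bessel_series.
Qed.

Let cont_even a b u : -1 < a -> pos_continuous (even_part a b u).
Proof.
move=> a1; apply: pos_continuousM; first exact: gamma_density_continuous.
exact: cont_series.
Qed.

Let cont_odd a b u : -1 < a -> pos_continuous (odd_part a b u).
Proof.
move=> a1; apply: pos_continuousM; first exact: gamma_density_continuous.
apply: pos_continuousM; last by apply: cont_series; lra.
by move=> w _; apply: cvgM; [exact: mulrl_continuous|exact: cvg_cst].
Qed.

Let even_ge0 a b u w : -1 < a -> 0 <= even_part a b u w.
Proof.
move=> a1; rewrite mulr_ge0 ?gamma_density_ge0//.
by rewrite bessel_series_ge0 ?sqr_ge0.
Qed.

Let odd_ge0 a b u w : -1 < a -> 0 <= u -> 0 < w -> 0 <= odd_part a b u w.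
Proof.
move=> a1 u0 w0; rewrite mulr_ge0 ?gamma_density_ge0// mulr_ge0//.
  by rewrite divr_ge0// mulr_ge0// ltW.
by rewrite bessel_series_ge0 ?sqr_ge0//; lra.
Qed.

Let even_integral a b u : -1 < a -> 0 < b ->
  (\int[mu]_(w in D) (even_part a b u w)%:E = even_series a b u)%E.
Proof. by move=> a1 b0; exact: bessel_series_moment. Qed.

Let odd_term_ge0 a b u k : -1 < a -> 0 < b -> 0 <= u ->
  0 <= moment_coef (b + 1) (a + 1) k / 2 * u * (u ^+ 2) ^+ k.
Proof.
move=> a1 b0 u0; apply: mulr_ge0; last by rewrite exprn_ge0// sqr_ge0.
apply: mulr_ge0 => //; apply: divr_ge0 => //; apply: ltW.
by apply: moment_coef_gt0; lra.
Qed.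

Let odd_integral a b u : -1 < a -> 0 < b -> 0 <= u ->
  (\int[mu]_(w in D) (odd_part a b u w)%:E = odd_series a b u)%E.
Proof.
move=> a1 b0 u0.
have u20 : 0 <= u / 2 by rewrite divr_ge0.
have a2 : -1 < a + 1 by lra.
have b1 : 0 < b + 1 by lra.
transitivity ((u / 2)%:E * \int[mu]_(w in D) (even_part (a + 1) (b + 1) u w)%:E)%E.
  rewrite -ge0_integralZl_EFin//=; last 2 first.
  - by move=> w _; rewrite lee_fin even_ge0.
  - by apply/measurable_EFinP; apply: pos_continuous_measurable; exact: cont_even.
  apply: eq_integral => w; rewrite inE/= in_itv/= andbT => w0.
  rewrite -EFinM; congr EFin; rewrite /odd_part /even_part.
  rewrite [b + 1]addrC -(gamma_density_moment b 1 w0) expr1.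
  by move: (bessel_series _ _) (gamma_density _ _) => F G; ring.
rewrite even_integral// /even_series -nneseriesZl; last first.
  move=> k _; rewrite lee_fin mulr_ge0 ?exprn_ge0 ?sqr_ge0//.
  by rewrite ltW// moment_coef_gt0.
apply: eq_eseriesr => k _; rewrite -EFinM; congr EFin.
by move: (moment_coef _ _ _) (_ ^+ k) => G X; ring.
Qed.

Let profile_pos a b u : - 2^-1 <= a -> 0 < b -> 0 <= u ->
  (dunkl_riesz_profile a b u = even_series a b u + odd_series a b u)%E.
Proof.
move=> ha b0 u0; have a1 : -1 < a by lra.
rewrite -even_integral// -odd_integral// -ge0_integralD//=; last 4 first.
- by move=> w _; rewrite lee_fin even_ge0.
- by apply/measurable_EFinP; apply: pos_continuous_measurable; exact: cont_even.
- by move=> w; rewrite in_itv/= andbT => w0; rewrite lee_fin odd_ge0.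
- by apply/measurable_EFinP; apply: pos_continuous_measurable; exact: cont_odd.
apply: eq_integral => w _; rewrite -EFinD; congr EFin.
by rewrite /dunkl_profile mulrDr.
Qed.

Let profile_neg a b u : - 2^-1 <= a -> 0 < b -> 0 <= u ->
  (dunkl_riesz_profile a b (- u) + odd_series a b u = even_series a b u)%E.
Proof.
move=> ha b0 u0; have a1 : -1 < a by lra.
rewrite -even_integral// -odd_integral// -ge0_integralD//=; last 4 first.
- by move=> w _; rewrite lee_fin mulr_ge0 ?gamma_density_ge0 ?dunkl_profile_ge0.
- apply/measurable_EFinP; apply: pos_continuous_measurable.
  exact: dunkl_riesz_integrand_continuous.
- by move=> w; rewrite in_itv/= andbT => w0; rewrite lee_fin odd_ge0.
- by apply/measurable_EFinP; apply: pos_continuous_measurable; exact: cont_odd.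
apply: eq_integral => w _; rewrite -EFinD; congr EFin.
rewrite /dunkl_profile !mulNr sqrrN -mulrDr /even_part; congr (_ * _).
by rewrite subrK.
Qed.

Let ratio_bounds a s k : - 2^-1 <= a -> 0 < s -> s < a + 1 ->
  let r := ((2 * k)%:R + (a + 1 - s)) / ((2 * k)%:R + 2 * (a + 1)) in
  0 <= r <= 1 /\ 1 - r <= (a + 1 + s) * k.+1%:R^-1.
Proof.
move=> ha s0 sa /=.
have k0 : 0 <= k%:R :> R by [].
have d0 : 0 < (2 * k)%:R + 2 * (a + 1) :> R by rewrite natrM; lra.
have a10 : 0 < a + 1 by lra.
split.
  rewrite divr_ge0 ?(ltW d0)//=; last by rewrite natrM; lra.
  by rewrite ler_pdivrMr// natrM; lra.
rewrite (_ : 1 - _ = (a + 1 + s) / ((2 * k)%:R + 2 * (a + 1))); last first.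
  rewrite -[X in X - _](divff (lt0r_neq0 d0)) -mulrBl; congr (_ / _); ring.
apply: ler_wpM2l; first by lra.
by rewrite lef_pV2 ?posrE// natrM -natr1; lra.
Qed.

(** Pointwise, e^(-w) times the profile function at u w/2 is at least a multiple
of e^(-2w). *)
Lemma dunkl_riesz_profile_lower a b : - 2^-1 <= a -> 0 < b ->
  exists2 m : R, 0 < m &
    forall u, `|u| <= 1 -> (m%:E <= dunkl_riesz_profile a b u)%E.
Proof.
move=> ha b0; have a1 : -1 < a by lra.
have c0 := bessel_coef_gt0 0 a1.
exists (bessel_coef a 0 * (2 `^ (- b) * euler_gamma b)).
  by rewrite mulr_gt0// mulr_gt0 ?powR_gt0 ?euler_gamma_gt0.
move=> u u1; rewrite EFinM -gamma_integral_exp//.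
have ce : pos_continuous (fun w => w `^ (b - 1) * expR (- (2 * w))).
  apply: pos_continuousM; first exact: pos_continuous_powR.
  move=> w _; apply: (@continuous_comp _ _ _ (fun w : R => - (2 * w)) expR).
    by apply: cvgN; exact: mulrl_continuous.
  exact: continuous_expR.
rewrite -ge0_integralZl_EFin//=; last 3 first.
- by move=> w _; rewrite lee_fin mulr_ge0 ?powR_ge0 ?expR_ge0.
- by apply/measurable_EFinP; exact: pos_continuous_measurable.
- exact: ltW.
apply: ge0_le_integral => //=.
- by move=> w _; rewrite -EFinM lee_fin !mulr_ge0 ?powR_ge0 ?expR_ge0// ltW.
- apply: emeasurable_funM; first exact: measurable_cst.
  by apply/measurable_EFinP; exact: pos_continuous_measurable.
- apply/measurable_EFinP; apply: pos_continuous_measurable.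
  exact: dunkl_riesz_integrand_continuous.
- move=> w; rewrite in_itv/= andbT => w0; rewrite -EFinM lee_fin /gamma_density.
  rewrite mulrCA -mulrA ler_wpM2l ?powR_ge0//.
  rewrite (_ : - (2 * w) = - w + - w); last by ring.
  rewrite expRD mulrCA ler_wpM2l ?expR_ge0//.
  apply: le_trans (dunkl_profile_ge _ ha); rewrite ler_wpM2l ?(ltW c0)//.
  have n2 : `|2^-1| = 2^-1 :> R by rewrite ger0_norm ?invr_ge0.
  rewrite ler_expR lerN2 !normrM (gtr0_norm w0) n2.
  rewrite (_ : 2 * _ = `|u| * w); last by field.
  by rewrite ler_piMl// ltW.
Qed.

(** The even part has coefficients of order (k+1)^(-s-1/2), and the odd part lies
between 0 and the even part. *)
Lemma dunkl_riesz_profile_pos a s : - 2^-1 <= a -> 0 < s -> s < a + 1 ->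
  exists2 C : R, 0 < C & forall u, 0 <= u <= 1 ->
   ((C^-1)%:E * polylog_series (s + 2^-1) (u ^+ 2)
     <= dunkl_riesz_profile a (a + 1 - s) u
     <= C%:E * polylog_series (s + 2^-1) (u ^+ 2))%E.
Proof.
move=> ha s0 sa; have a1 : -1 < a by lra.
set b := a + 1 - s; have b0 : 0 < b by rewrite /b; lra.
have mc0 k : 0 <= moment_coef b a k by rewrite ltW// moment_coef_gt0.
have A := moment_coef_asymp b0 a1.
have [C C0 HC] := two_sided_nneseries
   mc0 (fun k => powR_ge0 _ _) A.
have E : b - a - 3 / 2 = - (s + 2^-1) by rewrite /b; field.
exists (2 * C); first by rewrite mulr_gt0.
move=> u /andP[u0 u1]; rewrite profile_pos//.
have := HC (u ^+ 2) (sqr_ge0 u); rewrite E -/(polylog_series _ _) -/(even_series a b u).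
move=> /andP[h1 h2].
have T0 : (0 <= polylog_series (s + 2^-1) (u ^+ 2))%E.
  by apply: le_trans (polylog_ge1 _ (sqr_ge0 u)).
have uk k : 0 <= (u ^+ 2) ^+ k by rewrite exprn_ge0// sqr_ge0.
have O0 : (0 <= odd_series a b u)%E.
  by apply: nneseries_ge0 => k _ _; rewrite lee_fin odd_term_ge0.
have OE : (odd_series a b u <= even_series a b u)%E.
  apply: lee_nneseries => [k _ _|k _]; rewrite lee_fin.
    exact: odd_term_ge0.
  rewrite ler_wpM2r// moment_coef_odd// -mulrA ler_piMr//.
  have [/andP[r0 r1] _] := ratio_bounds k ha s0 sa.
  by rewrite mulr_ile1.
apply/andP; split.
  apply: (@le_trans _ _ (even_series a b u)); last by rewrite leeDl.
  apply: le_trans h1; apply: lee_wpmul2r => //.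
  by rewrite lee_fin lef_pV2 ?posrE ?mulr_gt0// ler_peMl ?ler1n// ltW.
apply: (@le_trans _ _ (even_series a b u + even_series a b u)%E); first by rewrite leeD2l.
by rewrite mulr2n mulrDl mul1r EFinD ge0_muleDl ?lee_fin ?(ltW C0)// leeD.
Qed.

(** The cancellation for x y < 0: with c_k the even coefficients and r_k the
ratio of odd to even, c_k u^(2k) (1 - r_k u) splits into c_k (1 - r_k) u^(2k),
summable because c_k (1 - r_k) is of order (k+1)^(-s-3/2), and
c_k r_k (1 - u) u^(2k), bounded by a geometric series. *)
Let even_partial_le a s : - 2^-1 <= a -> 0 < s -> s < a + 1 ->
  exists2 M : R, 0 < M & forall n u, 0 <= u < 1 ->
   \sum_(0 <= k < n) moment_coef (a + 1 - s) a k * (u ^+ 2) ^+ k <=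
   \sum_(0 <= k < n) moment_coef (a + 1 - s + 1) (a + 1) k / 2 * u * (u ^+ 2) ^+ k
   + M.
Proof.
move=> ha s0 sa; have a1 : -1 < a by lra.
set b := a + 1 - s; have b0 : 0 < b by rewrite /b; lra.
have [C C0 HC] := moment_coef_asymp b0 a1.
have E : b - a - 3 / 2 = - (s + 2^-1) by rewrite /b; field.
have e0 : 0 < s + 2^-1 by rewrite addr_gt0// invr_gt0.
have [M M0 HM] := sum_powRN_bounded e0.
pose B := a + 1 + s.
have B0 : 0 < B by rewrite /B; lra.
exists (C * B * M + C); first by rewrite addr_gt0// !mulr_gt0.
move=> n u /andP[u0 u1].
have up k : k.+1%:R `^ (- (s + 2^-1)) <= 1 :> R.
  by rewrite powRN invf_le1 ?powR_gt0// -[leLHS](powRr0 k.+1%:R) ler_powR ?ler1n// ltW.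
have c0 k : 0 <= moment_coef b a k by rewrite ltW// moment_coef_gt0.
rewrite -lerBlDl -sumrB.
apply: (@le_trans _ _ (\sum_(0 <= k < n)
   (C * B * k.+1%:R `^ (- 1 - (s + 2^-1)) + C * ((1 - u) * u ^+ k)))).
  apply: ler_sum => k _; rewrite moment_coef_odd//.
  set r := _ / _; set c := moment_coef b a k.
  have [/andP[r0 r1] r2] := ratio_bounds k ha s0 sa.
  rewrite -/b -/r in r0 r1 r2.
  have /andP[_ cC] := HC k; rewrite E -/c in cC.
  have cC' : c <= C by apply: (le_trans cC); rewrite ler_piMr// ltW.
  have U0 : 0 <= (u ^+ 2) ^+ k by rewrite exprn_ge0// sqr_ge0.
  have U1 : (u ^+ 2) ^+ k <= u ^+ k.
    by rewrite lerXn2r ?nnegrE ?sqr_ge0// expr2 ler_piMl// ltW.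
  have Uk1 : u ^+ k <= 1 by rewrite exprn_ile1// ltW.
  set U := (u ^+ 2) ^+ k in U0 U1 *.
  have cp : 0 <= c := c0 k.
  clearbody r c U.
  rewrite (_ : c * U - c * r * u * U = c * (1 - r) * U + c * r * (1 - u) * U); last by ring.
  apply: lerD.
    apply: (@le_trans _ _ (c * (1 - r))).
      rewrite ler_piMr ?(le_trans U1)// mulr_ge0 ?cp// subr_ge0//.
    rewrite powRD; last by rewrite pnatr_eq0 implybT.
    rewrite powR_inv1// -mulrA [k.+1%:R^-1 * _]mulrC.
    rewrite (_ : C * (B * _) = C * k.+1%:R `^ (- (s + 2^-1)) * (B * k.+1%:R^-1)); last by ring.
    by rewrite ler_pM// ?cp ?subr_ge0.
  have u1' : 0 <= 1 - u by rewrite subr_ge0 ltW.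
  have V0 : 0 <= (1 - u) * U by rewrite mulr_ge0.
  rewrite -!mulrA; apply: ler_pM; rewrite ?mulr_ge0//.
  by apply: (@le_trans _ _ ((1 - u) * U)); [rewrite ler_piMl|rewrite ler_wpM2l].
rewrite big_split/= -!mulr_sumr; apply: lerD.
  by rewrite ler_pM2l ?mulr_gt0.
rewrite ler_piMr ?(ltW C0)//.
have -> : (1 - u) * (\sum_(0 <= k < n) u ^+ k) = 1 - u ^+ n.
  elim: (n) => [|m IH]; first by rewrite big_nil mulr0 subrr.
  by rewrite big_nat_recr//= mulrDr IH exprS; ring.
by rewrite gerBl exprn_ge0.
Qed.

Let odd_series_fin a s u : - 2^-1 <= a -> 0 < s -> s < a + 1 -> 0 <= u < 1 ->
  (odd_series a (a + 1 - s) u < +oo)%E.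
Proof.
move=> ha s0 sa /andP[u0 u1]; have a1 : -1 < a by lra.
set b := a + 1 - s; have b0 : 0 < b by rewrite /b; lra.
have [C C0 HC] := moment_coef_asymp b0 a1.
have E : b - a - 3 / 2 = - (s + 2^-1) by rewrite /b; field.
apply: (@le_lt_trans _ _ (C / (1 - u))%:E); last exact: ltry.
apply: lime_le.
  by apply: is_cvg_nneseries => k _ _; rewrite lee_fin odd_term_ge0.
apply: nearW => n; rewrite sumEFin lee_fin.
apply: (@le_trans _ _ (\sum_(0 <= k < n) C * u ^+ k)).
  apply: ler_sum => k _; rewrite moment_coef_odd//.
  have [/andP[r0 r1] _] := ratio_bounds k ha s0 sa.
  have /andP[_ cC] := HC k; rewrite E in cC.
  have cC' : moment_coef b a k <= C.
    apply: (le_trans cC); rewrite ler_piMr ?(ltW C0)//.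
    rewrite powRN invf_le1 ?powR_gt0// -[leLHS](powRr0 k.+1%:R) ler_powR ?ler1n//.
    by rewrite addr_ge0 ?invr_ge0// ltW.
  have c0 : 0 <= moment_coef b a k by rewrite ltW// moment_coef_gt0.
  move: (moment_coef b a k) (_ / _) c0 cC' r0 r1 => c r c0 cC' r0 r1.
  apply: ler_pM; first by rewrite !mulr_ge0.
  - by rewrite exprn_ge0// sqr_ge0.
  - rewrite -mulrA; apply: le_trans cC'; rewrite ler_piMr//.
    by rewrite mulr_ile1// ltW.
  - by rewrite lerXn2r ?nnegrE ?sqr_ge0// expr2 ler_piMl// ltW.
rewrite -mulr_sumr ler_wpM2l ?(ltW C0)//.
have h : 0 < 1 - u by rewrite subr_gt0.
rewrite -[leRHS]mul1r ler_pdivlMr//.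
have -> : (\sum_(0 <= k < n) u ^+ k) * (1 - u) = 1 - u ^+ n.
  elim: (n) => [|m IH]; first by rewrite big_nil mul0r subrr.
  by rewrite big_nat_recr//= mulrDl IH exprS; ring.
by rewrite gerBl exprn_ge0.
Qed.

Let profile_neg_lt1 a s : - 2^-1 <= a -> 0 < s -> s < a + 1 ->
  exists2 M : R, 0 < M & forall u, 0 <= u < 1 ->
   (dunkl_riesz_profile a (a + 1 - s) (- u) <= M%:E)%E.
Proof.
move=> ha s0 sa; have a1 : -1 < a by lra.
have b0 : 0 < a + 1 - s by lra.
have [M M0 HM] := even_partial_le ha s0 sa.
exists M => // u u01; have /andP[u0 u1] := u01.
have fO := odd_series_fin ha s0 sa u01.
have t0 k : (0 <= (moment_coef (a + 1 - s + 1) (a + 1) k / 2 * u * (u ^+ 2) ^+ k)%:E)%E.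
  by rewrite lee_fin odd_term_ge0.
have O0 : (0 <= odd_series a (a + 1 - s) u)%E by exact: nneseries_ge0.
have fin : odd_series a (a + 1 - s) u \is a fin_num by rewrite ge0_fin_numE.
rewrite -(@leeD2rE _ (odd_series a (a + 1 - s) u))// profile_neg// addeC.
apply: lime_le.
  apply: is_cvg_nneseries => k _ _; rewrite lee_fin mulr_ge0//.
    by rewrite ltW// moment_coef_gt0.
  by rewrite exprn_ge0// sqr_ge0.
apply: nearW => n; rewrite sumEFin.
apply: (@le_trans _ _ ((\sum_(0 <= k < n)
   moment_coef (a + 1 - s + 1) (a + 1) k / 2 * u * (u ^+ 2) ^+ k)%:E + M%:E)%E).
  by rewrite -EFinD lee_fin HM.
by rewrite leeD2r// -sumEFin; apply: nneseries_lim_ge.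
Qed.

(** At u = -1, where the two series may both diverge, the bound follows from
Fatou's lemma as u tends to -1. *)
Lemma dunkl_riesz_profile_neg a s : - 2^-1 <= a -> 0 < s -> s < a + 1 ->
  exists2 M : R, 0 < M & forall u, 0 <= u <= 1 ->
   (dunkl_riesz_profile a (a + 1 - s) (- u) <= M%:E)%E.
Proof.
move=> ha s0 sa; have a1 : -1 < a by lra.
have [M M0 HM] := profile_neg_lt1 ha s0 sa; exists M => // u /andP[u0 u1].
pose th n : R := u * (1 - n.+1%:R^-1).
have th01 n : 0 <= th n < 1.
  have h : n.+1%:R^-1 <= 1 :> R by rewrite invf_le1// ler1n.
  have h' : 0 < n.+1%:R^-1 :> R by rewrite invr_gt0.
  rewrite /th mulr_ge0 ?subr_ge0//=.
  apply: (@le_lt_trans _ _ (1 * (1 - n.+1%:R^-1))); last by rewrite mul1r gtrBl.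
  by rewrite ler_wpM2r// subr_ge0.
pose g (v : R) w := gamma_density (a + 1 - s) w * dunkl_profile a (v * w / 2).
pose f n w := (g (- th n) w)%:E.
have cvgf w : f^~ w @ \oo --> (g (- u) w)%:E.
  apply: cvg_EFin; first exact: nearW.
  apply: cvgM; first exact: cvg_cst.
  apply: (cvg_comp (fun n => - th n * w / 2) (dunkl_profile a)); last exact: continuous_dunkl_profile.
  apply: cvgM; last exact: cvg_cst.
  apply: cvgM; last exact: cvg_cst.
  apply: cvgN; rewrite -[X in _ --> X]mulr1 /th; apply: cvgM; first exact: cvg_cst.
  rewrite -[X in _ --> X]subr0; apply: cvgB; first exact: cvg_cst.
  exact: cvg_harmonic.
have mf n : measurable_fun D (f n).
  apply/measurable_EFinP; apply: pos_continuous_measurable.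
  exact: dunkl_riesz_integrand_continuous.
have f0 n w : D w -> (0 <= f n w)%E.
  by move=> _; rewrite lee_fin mulr_ge0 ?gamma_density_ge0 ?dunkl_profile_ge0.
have := @fatou _ (measurableTypeR R) R mu D (measurable_itv _) f mf f0.
have -> : (\int[mu]_(w in D) limn_einf (f^~ w) = dunkl_riesz_profile a (a + 1 - s) (- u))%E.
  by apply: eq_integral => w _; have [-> _] := cvg_limn_einf_sup (cvgf w).
move=> /le_trans; apply.
rewrite limn_einf_lim; apply: lime_le; first exact: is_cvg_einfs.
apply: nearW => n; apply: (@le_trans _ _ (\int[mu]_(w in D) f n w)%E).
  by apply: ereal_inf_lbound; exists n => /=.
exact: HM.
Qed.

End ProfileBounds.

(** * Comparability in the extended reals *)

Section Comparison.
Context {R : realType}.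
Implicit Types (a b s x y u v q S C m M r : R) (X Y Z : \bar R).

Definition comparable_by C X Y := ((C^-1)%:E * Y <= X <= C%:E * Y)%E.

Lemma comparable_by_trans C C' X Y Z : 0 < C -> 0 < C' ->
  comparable_by C X Y -> comparable_by C' Y Z -> comparable_by (C * C') X Z.
Proof.
move=> C0 C'0 /andP[h1 h2] /andP[h3 h4]; apply/andP; split.
  rewrite invfM EFinM -muleA; apply: le_trans h1.
  by rewrite lee_pmul2l// ?lte_fin ?invr_gt0.
by rewrite EFinM -muleA; apply: (le_trans h2); rewrite lee_pmul2l// ?lte_fin.
Qed.

Lemma comparable_by_weaken C C' X Y : 0 < C -> C <= C' -> (0 <= Y)%E ->
  comparable_by C X Y -> comparable_by C' X Y.
Proof.
move=> C0 CC' Y0 /andP[h1 h2]; apply/andP; split.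
  apply: le_trans h1; apply: lee_wpmul2r => //; rewrite lee_fin.
  by rewrite lef_pV2 ?posrE// (lt_le_trans C0).
by apply: (le_trans h2); apply: lee_wpmul2r => //; rewrite lee_fin.
Qed.

Lemma comparable_byZ C r X Y : 0 < r -> comparable_by C X Y ->
  comparable_by C (r%:E * X)%E (r%:E * Y)%E.
Proof.
move=> r0 /andP[h1 h2]; rewrite /comparable_by !(muleCA _ r%:E).
by rewrite !lee_pmul2l ?lte_fin// h1 h2.
Qed.

Lemma comparable_by_scal C r r' X : 0 < C -> (0 <= X)%E ->
  C^-1 * r' <= r <= C * r' -> comparable_by C (r%:E * X)%E (r'%:E * X)%E.
Proof.
move=> C0 X0 /andP[h1 h2]; rewrite /comparable_by !muleA -!EFinM.
by apply/andP; split; apply: lee_wpmul2r.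
Qed.

Lemma comparable_by_fin C r r' :
  C^-1 * r' <= r <= C * r' -> comparable_by C r%:E r'%:E.
Proof. by move=> /andP[h1 h2]; rewrite /comparable_by -!EFinM !lee_fin h1 h2. Qed.

Lemma comparable_by_pinfty C : 0 < C -> comparable_by C +oo +oo.
Proof. by move=> C0; rewrite /comparable_by !gt0_muley ?lte_fin ?invr_gt0 ?leey. Qed.

(** Two quantities confined to fixed compact intervals of positive numbers are
comparable. *)
Lemma comparable_by_box m M X (Y : R) c d : 0 < m -> 0 < M -> 0 < c -> c <= Y <= d ->
  (m%:E <= X <= M%:E)%E -> comparable_by (d / m + M / c) X Y%:E.
Proof.
move=> m0 M0 c0 /andP[cY Yd] /andP[mX XM].
have Y0 : 0 < Y by exact: lt_le_trans cY.
have d0 : 0 < d by exact: lt_le_trans Yd.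
have C1 : 0 < d / m by rewrite divr_gt0.
have C2 : 0 < M / c by rewrite divr_gt0.
apply/andP; split; rewrite -EFinM.
  apply: le_trans mX; rewrite lee_fin ler_pdivrMl ?addr_gt0//.
  rewrite mulrDl divfK ?gt_eqF//; apply: (le_trans Yd).
  by rewrite lerDl mulr_ge0// ltW.
apply: (le_trans XM); rewrite lee_fin mulrDl.
apply: ler_wpDl; first by rewrite mulr_ge0// ltW.
by rewrite mulrAC ler_pdivlMr// ler_pM2l.
Qed.

Lemma powR_ratio_bounds r v : 1 <= v <= 2 -> 2 `^ (- `|r|) <= v `^ r <= 2 `^ `|r|.
Proof.
move=> /andP[v1 v2].
have v0 : 0 < v by exact: lt_le_trans v1.
have h : v `^ `|r| <= 2 `^ `|r| by rewrite ge0_ler_powR ?nnegrE// ltW.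
apply/andP; split.
  apply: (@le_trans _ _ (v `^ (- `|r|))).
    by rewrite !powRN lef_pV2 ?posrE ?powR_gt0.
  by rewrite ler_powR// lerNl -normrN ler_norm.
by apply: le_trans h; rewrite ler_powR// ler_norm.
Qed.

Lemma ln2_bounds : 2^-1 <= ln (2 : R) <= 1.
Proof.
apply/andP; split; last by have := @le_ln1Dx R 1; apply; lra.
have := @le_ln1Dx R (- 2^-1).
rewrite (_ : 1 + - 2^-1 = 2^-1); last by field.
by rewrite lnV ?posrE// lerN2; apply; lra.
Qed.

(** Comparison with exponent 1, where the logarithmic bound at
v = 1 - e^(-2A) exceeds A. *)
Lemma polylog_diverges p : p <= 1 -> polylog_series p (1 : R) = +oo%E.
Proof.
move=> p1; apply/eqyP => A A0.
apply: (@le_trans _ _ (polylog_series 1 (1 : R))); last first.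
  apply: lee_nneseries => [k _ _|k _]; rewrite lee_fin.
    exact: polylog_term_ge0.
  by rewrite !expr1n !mulr1 ler_powR ?ler1n// lerN2.
pose v := 1 - expR (- (2 * A)) : R.
have e1 : expR (- (2 * A)) < 1 by rewrite expR_lt1 oppr_lt0 mulr_gt0.
have v01 : 0 <= v < 1 by rewrite /v subr_ge0 (ltW e1) gtrBl expR_gt0.
apply: (@le_trans _ _ (polylog_series 1 v)); last first.
  by apply: polylog_series_mono; case/andP: v01 => -> /ltW ->.
have := polylog1_ge v01.
by rewrite /v subKr expRK opprK EFinM lee_pmul2l// lte_fin.
Qed.

End Comparison.

(** * Elementary inequalities in the plane *)

Section Geometry.
Context {R : realType}.
Implicit Types (x y : R).

Let absS x y : (`|x| + `|y|) ^+ 2 = x ^+ 2 + y ^+ 2 + 2 * `|x * y|.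
Proof.
rewrite normrM sqrrD !real_normK ?num_real//.
by rewrite -mulr_natl; ring.
Qed.

Lemma sqr_sum_bounds x y :
  x ^+ 2 + y ^+ 2 <= (`|x| + `|y|) ^+ 2 <= 2 * (x ^+ 2 + y ^+ 2).
Proof.
rewrite absS; apply/andP; split; first by rewrite lerDl mulr_ge0.
have : `|x * y| * 2 <= x ^+ 2 + y ^+ 2.
  have := sqr_ge0 (`|x| - `|y|).
  rewrite sqrrB !real_normK ?num_real// -normrM -mulr_natr.
  lra.
lra.
Qed.

Lemma norm_cross_ratio x y : 0 < x ^+ 2 + y ^+ 2 ->
  `|2 * (x * y) / (x ^+ 2 + y ^+ 2)| <= 1.
Proof.
move=> q0; rewrite normrM normfV (gtr0_norm q0) ler_pdivrMr// mul1r.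
have -> : `|2 * (x * y)| = 2 * `|x * y| by rewrite normrM ger0_norm.
have /andP[_] := sqr_sum_bounds x y; rewrite absS.
lra.
Qed.

(** With S = |x| + |y|, D = |x - y| and q = x^2 + y^2: for x y >= 0,
q - 2xy = D^2 and q + 2xy = S^2. *)
Lemma one_sub_sqr_cross_ratio x y : 0 < x ^+ 2 + y ^+ 2 -> 0 <= x * y ->
  1 - (2 * (x * y) / (x ^+ 2 + y ^+ 2)) ^+ 2 =
  ((`|x| + `|y|) * `|x - y| / (x ^+ 2 + y ^+ 2)) ^+ 2.
Proof.
move=> q0 xy0; rewrite !exprMn absS ger0_norm// real_normK ?num_real//.
by field; rewrite gt_eqF.
Qed.

Lemma norm_sub_opposite x y : x * y <= 0 -> `|x - y| = `|x| + `|y|.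
Proof.
move=> xy; apply/eqP; rewrite -(@eqrXn2 _ 2)// ?addr_ge0//; apply/eqP.
rewrite absS real_normK ?num_real// ler0_norm//.
ring.
Qed.

Lemma norm_sub_le x y : `|x - y| <= `|x| + `|y|.
Proof. exact: ler_normB. Qed.

Lemma norm_sum_gt0 x y : (x, y) != (0, 0) -> 0 < `|x| + `|y|.
Proof.
move=> h; rewrite lt_neqAle addr_ge0// andbT eq_sym paddr_eq0// !normr_eq0.
by move: h; rewrite xpair_eqE.
Qed.

Lemma sqr_sum_gt0 x y : (x, y) != (0, 0) -> 0 < x ^+ 2 + y ^+ 2.
Proof.
move=> h; rewrite lt_neqAle addr_ge0 ?sqr_ge0// andbT eq_sym paddr_eq0 ?sqr_ge0//.
by rewrite !sqrf_eq0; move: h; rewrite xpair_eqE.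
Qed.

End Geometry.

(** * Comparison with the size function *)

Section RieszSize.
Context {R : realType}.
Implicit Types (a s x y u v C r om tau : R).

(** The size function divided by S^(2(s - a - 1)), as a function of the
scale-invariant quantity om = |x - y| / (|x| + |y|). *)
Definition size_ratio s om : \bar R :=
  (if s < 2^-1 then powRy om (2 * s - 1)
   else if s == 2^-1 then lne (2%:E / om%:E)%E else 1%E).

Lemma riesz_size_off0E a s x y : (x, y) != (0, 0) ->
  riesz_size_off0 a s (x, y) = (((`|x| + `|y|) `^ (2 * (s - a - 1)))%R%:E *
    size_ratio s (`|x - y| / (`|x| + `|y|))%R)%E.
Proof.
move=> xy0; rewrite /riesz_size_off0 /size_ratio/=.
set S : R := `|x| + `|y|; set d : R := `|x - y|.
have S0 : 0 < S by exact: norm_sum_gt0.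
have d0 : 0 <= d by exact: normr_ge0.
have Sn : S != 0 by rewrite gt_eqF.
have Sp r : 0 < S `^ r by exact: powR_gt0.
have SD r r' : S `^ r * S `^ r' = S `^ (r + r') by rewrite powRD// Sn implybT.
have -> : powRy S (- 2 * a - 1) = (S `^ (- 2 * a - 1))%:E.
  by rewrite /powRy (negbTE Sn).
case: ifPn => [s2|s2].
  rewrite /powRy mulf_eq0 invr_eq0 (negbTE Sn) orbF.
  have -> : 2 * s - 1 < 0 by lra.
  rewrite andbT; have [_|dn] := eqVneq d 0; first by rewrite !gt0_muley ?lte_fin.
  rewrite -!EFinM powRM ?invr_ge0 ?(ltW S0)// mulrCA mulrC [d `^ _ * _]mulrC.
  rewrite -powR_inv1 ?(ltW S0)// -powRrM SD mulrC.
  by congr (_ * _ `^ _)%:E; ring.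
case: ifPn => [/eqP ->|sn].
  have -> : 2 * (2^-1 - a - 1) = - 2 * a - 1 by field.
  congr (_ * lne _)%E.
  have [->|dn] := eqVneq d 0.
    by rewrite mul0r inve0 !gt0_muley ?lte_fin// mulr_gt0.
  rewrite !inver (negbTE dn) mulf_eq0 invr_eq0 (negbTE Sn) orbF (negbTE dn).
  by rewrite -!EFinM; congr EFin; field; rewrite dn Sn.
have -> : powRy S (2 * s - 1) = (S `^ (2 * s - 1))%:E.
  by rewrite /powRy (negbTE Sn).
by rewrite mule1 -EFinM SD; congr (_ `^ _)%:E; ring.
Qed.

Let lne_ratio om : 0 < om -> (lne (2%:E / om%:E) = (ln 2 - ln om)%:E)%E.
Proof.
move=> om0; rewrite inver gt_eqF// -EFinM lne_EFin ?divr_gt0//.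
by rewrite ln_div ?posrE.
Qed.

Lemma size_ratio_ge s om : 0 <= om <= 1 -> ((2^-1 : R)%:E <= size_ratio s om)%E.
Proof.
move=> /andP[om0 om1]; rewrite /size_ratio.
have h1 : ((2^-1 : R)%:E <= 1)%E by rewrite lee_fin invf_le1// ler1n.
case: ifPn => [s2|_].
  rewrite /powRy; have [_|omn] := eqVneq om 0.
    by rewrite (_ : 2 * s - 1 < 0) ?leey//; lra.
  have omp : 0 < om by rewrite lt_neqAle eq_sym omn.
  apply: (le_trans h1); rewrite lee_fin -[leLHS](powRr0 om).
  by apply: ger_powR; rewrite ?omp//; lra.
case: ifPn => [_|_] //.
have [->|omn] := eqVneq om 0; first by rewrite inve0 gt0_muley ?lte_fin//= leey.
have omp : 0 < om by rewrite lt_neqAle eq_sym omn.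
rewrite lne_ratio// lee_fin; have /andP[l2 _] := @ln2_bounds R.
by have := ln_le0 om1; lra.
Qed.

Lemma size_ratio1 s : exists2 c : R, 2^-1 <= c <= 1 & size_ratio s 1 = c%:E.
Proof.
have h1 : (2^-1 : R) <= 1 by rewrite invf_le1// ler1n.
rewrite /size_ratio; case: ifPn => _.
  by exists 1; rewrite ?h1 ?lexx// /powRy oner_eq0 powR1.
case: ifPn => _; last by exists 1; rewrite ?h1 ?lexx.
by exists (ln 2); [exact: ln2_bounds|rewrite lne_ratio// ln1 subr0].
Qed.

(** tau stands for S^2/q, so that 1 - v = (D S/q)^2 is (om tau)^2. The three
ranges of s give the three behaviours of the series of exponent s + 1/2 as v
tends to 1. *)
Lemma polylog_size_ratio s : 0 < s -> exists2 C : R, 0 < C &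
  forall v om tau, 0 <= v <= 1 -> 0 <= om <= 1 -> 1 <= tau <= 2 ->
    1 - v = (om * tau) ^+ 2 ->
    comparable_by C (polylog_series (s + 2^-1) v) (size_ratio s om).
Proof.
move=> s0; have [s2|s2] := ltP s 2^-1.
  have p1 : s + 2^-1 < 1 by lra.
  have [C C0 HC] := polylog_lt1 p1.
  pose E : R := 2 `^ `|2 * s - 1|.
  have E0 : 0 < E by rewrite powR_gt0.
  exists (C * E); first by rewrite mulr_gt0.
  move=> v om tau /andP[v0 v1] /andP[om0 om1] tau12 hv; rewrite /size_ratio s2.
  have [om_0|omn] := eqVneq om 0.
    have -> : v = 1 by move: hv; rewrite om_0 mul0r expr0n/=; lra.
    rewrite polylog_diverges ?(ltW p1)// /powRy om_0 eqxx (_ : 2 * s - 1 < 0); last by lra.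
    by apply: comparable_by_pinfty; rewrite mulr_gt0.
  have omp : 0 < om by rewrite lt_neqAle eq_sym omn.
  have tau0 : 0 < tau by case/andP: tau12 => h _; exact: lt_le_trans h.
  have v1' : v < 1 by rewrite -subr_gt0 hv exprn_gt0// mulr_gt0.
  have := HC v; rewrite v0 v1' => /(_ isT) h.
  apply: (comparable_by_trans C0 E0 h).
  rewrite /powRy (negbTE omn)/= hv; apply: comparable_by_fin.
  rewrite -powR_mulrn ?mulr_ge0 ?(ltW omp) ?(ltW tau0)// -powRrM powRM ?(ltW omp) ?(ltW tau0)//.
  have -> : 2%:R * (s + 2^-1 - 1) = 2 * s - 1 :> R by field.
  have /andP[h1 h2] := powR_ratio_bounds (2 * s - 1) tau12.
  rewrite powRN -/E in h1 h2.
  by rewrite ![_ * om `^ _]mulrC !ler_pM2l ?powR_gt0// h1 h2.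
have [->|sn] := eqVneq s 2^-1.
  exists 4 => // v om tau /andP[v0 v1] /andP[om0 om1] tau12 hv.
  rewrite /size_ratio ltxx eqxx.
  have -> : 2^-1 + 2^-1 = 1 :> R by field.
  have [om_0|omn] := eqVneq om 0.
    have -> : v = 1 by move: hv; rewrite om_0 mul0r expr0n/=; lra.
    rewrite polylog_diverges// om_0 inve0 gt0_muley ?lte_fin//=.
    exact: comparable_by_pinfty.
  have omp : 0 < om by rewrite lt_neqAle eq_sym omn.
  have tau0 : 0 < tau by case/andP: tau12 => h _; exact: lt_le_trans h.
  have v01 : 0 <= v < 1 by rewrite v0 -subr_gt0 hv exprn_gt0// mulr_gt0.
  have lv : ln (1 - v) = 2 * ln om + 2 * ln tau.
    by rewrite hv lnXn ?mulr_gt0// lnM ?posrE//; ring.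
  have lt0 : 0 <= ln tau by apply: ln_ge0; case/andP: tau12.
  have lt2 : ln tau <= ln 2.
    by rewrite ler_ln ?posrE//; case/andP: tau12.
  have lo : ln om <= 0 by exact: ln_le0.
  have /andP[l2 l2'] := @ln2_bounds R.
  have Tle := polylog1_le v01.
  have Tge := polylog1_ge v01.
  have T1 := polylog_ge1 1 v0.
  rewrite lne_ratio//.
  move: (polylog_series 1 v) Tle Tge T1 => [T||]//.
  rewrite -EFinM !lee_fin lv => Tle Tge T1; apply: comparable_by_fin.
  by apply/andP; split; [rewrite ler_pdivrMl//|]; lra.
have p1 : 1 < s + 2^-1.
  have : 2^-1 < s by rewrite lt_neqAle eq_sym sn.
  lra.
have [M M0 HM] := polylog_gt1_bounded p1.
exists (1 / 1 + M / 1); first by rewrite addr_gt0 ?divr_gt0.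
move=> v om tau v01 _ _ _; rewrite /size_ratio ltNge s2 (negbTE sn)/=.
apply: comparable_by_box => //; first by rewrite lexx.
by rewrite HM// polylog_ge1//; case/andP: v01.
Qed.

(** For x y <= 0, om = 1 and both sides are bounded above and below; for
x y > 0, the profile is compared with the power-law series at u^2. *)
Lemma profile_size_ratio a s : - 2^-1 <= a -> 0 < s -> s < a + 1 ->
  exists2 C : R, 0 < C & forall x y, (x, y) != (0, 0) ->
    comparable_by C
      (dunkl_riesz_profile a (a + 1 - s) (2 * (x * y) / (x ^+ 2 + y ^+ 2)))
      (size_ratio s (`|x - y| / (`|x| + `|y|))).
Proof.
move=> ha s0 sa.
have b0 : 0 < a + 1 - s by lra.
have [m m0 Hm] := dunkl_riesz_profile_lower ha b0.
have [M M0 HM] := dunkl_riesz_profile_neg ha s0 sa.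
have [C1 C10 H1] := dunkl_riesz_profile_pos ha s0 sa.
have [C2 C20 H2] := polylog_size_ratio s0.
pose C3 := 1 / m + M / 2^-1.
have C30 : 0 < C3 by rewrite addr_gt0 ?divr_gt0.
exists (C3 + C1 * C2); first by rewrite addr_gt0// mulr_gt0.
move=> x y xy0; have q0 := sqr_sum_gt0 xy0.
have /andP[qS Sq] := sqr_sum_bounds x y.
have u1 := norm_cross_ratio q0.
set q := x ^+ 2 + y ^+ 2 in q0 qS Sq u1 *.
set u := 2 * (x * y) / q in u1 *.
set S : R := `|x| + `|y| in qS Sq *.
have S0 : 0 < S by exact: norm_sum_gt0.
have om01 : 0 <= `|x - y| / S <= 1.
  by rewrite divr_ge0 ?(ltW S0)//= ler_pdivrMr// mul1r norm_sub_le.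
have Z0 : (0 <= size_ratio s (`|x - y| / S)%R)%E.
  by apply: le_trans (size_ratio_ge s om01); rewrite lee_fin invr_ge0.
have [xyn|xyp] := leP (x * y) 0.
  apply: (@comparable_by_weaken _ C3) => //; first by rewrite lerDl mulr_ge0// ltW.
  rewrite (norm_sub_opposite xyn) divff ?gt_eqF//.
  have [c c12 ->] := size_ratio1 s.
  apply: comparable_by_box => //; rewrite ?invr_gt0// Hm//=.
  have u0 : u <= 0 by rewrite /u pmulr_lle0 ?invr_gt0// pmulr_rle0.
  by rewrite -[u]opprK; apply: HM; rewrite oppr_ge0 u0/= -ler0_norm.
apply: (@comparable_by_weaken _ (C1 * C2)) => //; first by rewrite mulr_gt0.
  by rewrite lerDr ltW.
have u0 : 0 <= u by rewrite /u divr_ge0 ?(ltW q0)// mulr_ge0// ltW.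
have u1' : u <= 1 by rewrite -(ger0_norm u0).
apply: (@comparable_by_trans _ C1 C2 _ (polylog_series (s + 2^-1) (u ^+ 2))) => //.
  by apply: H1; rewrite u0.
apply: (H2 _ _ (S ^+ 2 / q)) => //.
- by rewrite sqr_ge0 exprn_ile1.
- by rewrite ler_pdivlMr// mul1r qS ler_pdivrMr.
- rewrite /u one_sub_sqr_cross_ratio ?(ltW xyp)// -/S -/q; congr (_ ^+ 2).
  by field; rewrite !gt_eqF.
Qed.

Lemma dunkl_riesz_kernel_off0 a s : - 2^-1 <= a -> 0 < s -> s < a + 1 ->
  exists2 C : R, 0 < C & forall x y, (x, y) != (0, 0) ->
    comparable_by C (dunkl_riesz_kernel a s x y) (riesz_size_off0 a s (x, y)).
Proof.
move=> ha s0 sa.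
have b0 : 0 < a + 1 - s by lra.
have [C C0 HC] := profile_size_ratio ha s0 sa.
pose r := s - a - 1.
pose k := (euler_gamma s)^-1 * 4 `^ (- s) : R.
have k0 : 0 < k by rewrite mulr_gt0 ?powR_gt0// invr_gt0 euler_gamma_gt0.
pose e : R := 2 `^ `|- r|.
have e0 : 0 < e by rewrite powR_gt0.
pose E := k * e + k^-1 * e.
have E0 : 0 < E by apply: addr_gt0; rewrite mulr_gt0 ?invr_gt0.
exists (E * C); first by rewrite mulr_gt0.
move=> x y xy0; have q0 := sqr_sum_gt0 xy0.
rewrite dunkl_riesz_kernelE// riesz_size_off0E//.
have /andP[qS Sq] := sqr_sum_bounds x y.
set q := x ^+ 2 + y ^+ 2 in q0 qS Sq *.
set S : R := `|x| + `|y| in qS Sq *.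
have S0 : 0 < S by exact: norm_sum_gt0.
set Ph := dunkl_riesz_profile _ _ _.
have Ph0 : (0 <= Ph)%E.
  by apply: integral_ge0 => w _; rewrite lee_fin mulr_ge0 ?gamma_density_ge0 ?dunkl_profile_ge0.
have Sr := powR_gt0 (2 * r) S0.
apply: (@comparable_by_trans _ E C _ ((S `^ (2 * r))%R%:E * Ph)%E) => //; last first.
  by apply: comparable_byZ => //; exact: HC.
apply: comparable_by_scal => //; rewrite mulrA -/k -/r.
have tau12 : 1 <= S ^+ 2 / q <= 2 by rewrite ler_pdivlMr// mul1r qS ler_pdivrMr.
have -> : q `^ r = S `^ (2 * r) * (S ^+ 2 / q) `^ (- r).
  rewrite powRM ?sqr_ge0 ?invr_ge0 ?(ltW q0)// -powR_mulrn ?(ltW S0)// -powR_inv1 ?(ltW q0)//.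
  rewrite -!powRrM mulrA -powRD; last by rewrite (gt_eqF S0) implybT.
  by rewrite mulN1r opprK (_ : _ + _ = 0) ?powRr0 ?mul1r//; ring.
have /andP[h1 h2] := powR_ratio_bounds (- r) tau12.
rewrite [2 `^ _]powRN -/e in h1.
rewrite mulrCA ![_ * S `^ _]mulrC !ler_pM2l//.
apply/andP; split.
  apply: (@le_trans _ _ (k * e^-1)); last by rewrite ler_pM2l.
  rewrite -[k]invrK -invfM lef_pV2 ?posrE ?mulr_gt0 ?invr_gt0//.
  by rewrite lerDr mulr_ge0// ltW.
apply: (@le_trans _ _ (k * e)); first by rewrite ler_pM2l.
by rewrite lerDl mulr_ge0 ?invr_ge0// ltW.
Qed.

Lemma powR_blowup r (A : R) : r < 0 -> 0 < A ->
  exists2 d : R, 0 < d & forall S : R, 0 < S -> S <= d -> A <= S `^ r.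
Proof.
move=> r0 A0; exists (A `^ (r^-1)); first exact: powR_gt0.
move=> S S0 Sd.
have h : S `^ (- r) <= (A `^ r^-1) `^ (- r).
  by rewrite ge0_ler_powR ?nnegrE ?powR_ge0 ?oppr_ge0// ltW.
rewrite -powRrM mulrN mulVf ?lt_eqF// powR_inv1 ?(ltW A0)// powRN in h.
by move: h; rewrite lef_pV2 ?posrE ?powR_gt0.
Qed.

(** The size function is homogeneous of negative degree 2(s - a - 1) and its
angular part is bounded below. *)
Lemma riesz_size_origin a s : s < a + 1 -> riesz_size a s 0 0 = +oo%E.
Proof.
move=> sa; rewrite /riesz_size /extend_by_limit ifF; last first.
  by apply/negbTE; rewrite notin_setE /= eqxx.
have r0 : 2 * (s - a - 1) < 0 by lra.
have PF : ProperFilter (within [set p : R * R | p != (0, 0)] (nbhs ((0, 0) : R * R))).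
  apply: within_nbhs_proper => B /nbhs_ballP[e /= e0 eB].
  exists (e / 2, 0); split => /=.
    by rewrite xpair_eqE negb_and gt_eqF ?divr_gt0.
  apply: eB; split; rewrite /ball/= ?subrr ?normr0// sub0r normrN.
  by rewrite gtr0_norm ?divr_gt0//; lra.
apply: cvg_lim => //; apply/cvgeyPge => A.
pose B := Num.max 1 (2 * A).
have B0 : 0 < B by rewrite lt_max ltr01.
have [d d0 Hd] := powR_blowup r0 B0.
rewrite near_withinE; apply/nbhs_ballP; exists (d / 2) => /=; first by rewrite divr_gt0.
move=> [x y] [/= bx by_] xy0.
rewrite riesz_size_off0E//.
rewrite /ball/= !sub0r !normrN in bx by_.
have S0 := norm_sum_gt0 xy0.
have hS : `|x| + `|y| <= d by lra.
have h := Hd _ S0 hS.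
have om01 : 0 <= `|x - y| / (`|x| + `|y|) <= 1.
  by rewrite divr_ge0 ?(ltW S0)//= ler_pdivrMr// mul1r norm_sub_le.
apply: (@le_trans _ _ (B%:E * (2^-1)%:E)%E).
  rewrite -EFinM lee_fin ler_pdivlMr// mulrC.
  by rewrite /B le_max lexx orbT.
by apply: lee_pmul; rewrite ?lee_fin ?invr_ge0 ?(ltW B0)//; exact: size_ratio_ge.
Qed.

(** The integrand at the origin dominates the one at (x, 0), as it lacks the
factor e^(-x^2/(4t)); the kernel at (x, 0) blows up as x tends to 0. *)
Lemma dunkl_riesz_kernel_origin a s : - 2^-1 <= a -> 0 < s -> s < a + 1 ->
  dunkl_riesz_kernel a s 0 0 = +oo%E.
Proof.
move=> ha s0 sa; have a1 : -1 < a by lra.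
have [C C0 HC] := dunkl_riesz_kernel_off0 ha s0 sa.
have r0 : 2 * (s - a - 1) < 0 by lra.
have mono x : (dunkl_riesz_kernel a s x 0 <= dunkl_riesz_kernel a s 0 0)%E.
  rewrite !dunkl_riesz_kernel_integral// lee_pmul2l// ?lte_fin ?invr_gt0 ?euler_gamma_gt0//.
  apply: ge0_le_integral => //=.
  - by move=> t _; rewrite lee_fin heat_integrand_ge0.
  - apply/measurable_EFinP; apply: pos_continuous_measurable.
    exact: heat_integrand_continuous.
  - apply/measurable_EFinP; apply: pos_continuous_measurable.
    exact: heat_integrand_continuous.
  - move=> t; rewrite in_itv/= andbT => t0; rewrite lee_fin /heat_integrand !mulr0.
    rewrite ler_wpM2r ?powR_ge0// ler_wpM2r ?dunkl_profile_ge0//.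
    rewrite ler_wpM2l ?powR_ge0// ler_expR expr0n/= addr0 !mulNr lerN2.
    by rewrite addr0 mul0r divr_ge0 ?sqr_ge0// mulr_ge0// ltW.
apply/eqyP => A A0.
have B0 : 0 < 2 * C * A by rewrite !mulr_gt0.
have [d d0 Hd] := powR_blowup r0 B0.
apply: le_trans (mono d).
have dn0 : (d, 0) != (0, 0) :> R * R by rewrite xpair_eqE negb_and gt_eqF.
have /andP[+ _] := HC d 0 dn0; apply: le_trans.
rewrite riesz_size_off0E// normr0 addr0 subr0 gtr0_norm// divff ?gt_eqF//.
have h := Hd d d0 (lexx d).
apply: (@le_trans _ _ ((C^-1)%:E * ((2 * C * A)%:E * (2^-1)%:E))%E).
  rewrite -!EFinM lee_fin le_eqVlt; apply/orP; left; apply/eqP.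
  by field; rewrite gt_eqF.
rewrite lee_pmul2l ?lte_fin ?invr_gt0//.
apply: lee_pmul; rewrite ?lee_fin ?invr_ge0 ?(ltW B0)//.
by apply: size_ratio_ge; rewrite ler01 lexx.
Qed.

End RieszSize.

Theorem theorem2p14 (R : realType) (a s : R) (ha : - 2^-1 <= a)
    (hs0 : 0 < s) (hs1 : s < a + 1) :
  exists2 C : R, 0 < C & forall x y : R,
    ((C^-1)%R%:E * riesz_size a s x y <= dunkl_riesz_kernel a s x y
       <= C%:E * riesz_size a s x y)%E.
Proof.
have [C C0 HC] := dunkl_riesz_kernel_off0 ha hs0 hs1; exists C => // x y.
have [[-> ->]|xy0] := eqVneq (x, y) (0, 0).
  rewrite riesz_size_origin// dunkl_riesz_kernel_origin//.
  exact: comparable_by_pinfty.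
rewrite /riesz_size /extend_by_limit ifT; first exact: HC.
by rewrite inE.
Qed.
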